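(* Let $P\subset\mathbb{H}^4$ be the hyperbolic regular right-angled $120$-cell, let $\mathcal{C}$ be the set of $24$ pairwise disjoint walls of $P$ whose normal vectors are the $8$ vectors obtained by permuting the last four coordinates of $(\sqrt{2\tau},\pm2,0,0,0)$ and the $16$ vectors $(\sqrt{2\tau},\pm1,\pm1,\pm1,\pm1)$, and let $\Gamma<G_4=\mathrm{Isom}(\mathbb{H}^4)<\mathrm{O}(1,4)$ be the discrete infinite covolume group generated by the reflections in the $96$ walls of $P$ not in $\mathcal{C}$. Then the inclusion map $\Gamma\to G_4$ is infinitesimally rigid in the representation variety $\mathrm{Hom}(\Gamma,G_4)$.
   Context: Minkowski form on $\mathbb{R}^5$: $(x,y)=-x_0y_0+\sum_{i=1}^4x_iy_i$; $\mathbb{H}^4=\{x:(x,x)=-1,x_0>0\}$; $\mathrm{O}(1,4)=\{A:A^TMA=M\}$, $M=\mathrm{diag}(-1,1,1,1,1)$; $G_4$ is the open subgroup of $\mathrm{O}(1,4)$ preserving $\mathbb{H}^4$. With $\tau=(1+\sqrt5)/2$, $P$ is the compact polytope bounded by the $120$ hyperplanes $\vec n^\perp\cap\mathbb{H}^4$ for $\vec n$ among the $24$ vectors listed above together with the $96$ vectors obtained by even permutations of the last four coordinates of $(\sqrt{2\tau},\pm\tau,\pm1,\pm\tau^{-1},0)$; its walls are dodecahedra, intersecting walls meet at right angles. The reflection in a wall with normal $\vec n$ is the element of $G_4$ fixing $\vec n^\perp$ and sending $\vec n\mapsto-\vec n$. $\Gamma$ has presentation $\langle r_1,\dots,r_{96}\mid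 r_i^2=1,\ (r_ir_j)^2=1 \text{ whenever the corresponding walls intersect}\rangle$. Given this presentation, $\mathrm{Hom}(\Gamma,\mathrm{O}(1,4))$ is the zero set in $V=\mathbb{R}^{25\cdot 96}$ (tuples of matrices $\rho(r_j)$) of the polynomial equations $P_\alpha$ expressing $\rho(r_j)^TM\rho(r_j)=M$ and each relation; $\mathrm{Hom}(\Gamma,G_4)$ is the union of components where each $\rho(r_j)$ has positive upper-left entry. $G_4$ acts by conjugation. An infinitesimal deformation of $\rho$ is a tangent vector $p'(0)\in T_\rho V$ of a smooth path $p:(-\varepsilon,\varepsilon)\to V$ with $p(0)=\rho$ and $\frac{d}{dt}|_0P_\alpha(p(t))=0$ for all $\alpha$; an infinitesimal conjugation is a tangent vector at $\rho$ to a smooth path in the orbit $G_4\cdot\rho$; $\rho$ is infinitesimally rigid if every infinitesimal deformation is an infinitesimal conjugation. *)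

(* Defs.v *)
From HB Require Import structures.
From mathcomp Require Import all_boot all_order all_algebra all_fingroup.
From mathcomp Require Import all_classical all_reals all_analysis.
Set Implicit Arguments. Unset Strict Implicit. Unset Printing Implicit Defensive.
Import Order.TTheory GRing.Theory Num.Theory.
Local Open Scope ring_scope.

Section Defs.
Variable R : realType.

Definition Mmink : 'M[R]_5 := diag_mx (\row_(i < 5) (if i == ord0 then -1 else 1)).
Definition mink (x y : 'cV[R]_5) : R := (x^T *m Mmink *m y) ord0 ord0.

Definition inH4 (x : 'cV[R]_5) : Prop := mink x x = -1 /\ 0 < x ord0 ord0.

Definition inG4 (g : 'M[R]_5) : Prop :=
  g^T *m Mmink *m g = Mmink /\ (forall x, inH4 x -> inH4 (g *m x)).

Definition tau : R := (1 + Num.sqrt 5) / 2.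
Definition sgb (b : bool) : R := if b then 1 else -1.

Definition vec5 (a : R) (w : 'I_4 -> R) : 'cV[R]_5 :=
  \col_(i < 5) (if unlift ord0 i is Some k then w k else a).

Definition normalsC : seq 'cV[R]_5 :=
  [seq vec5 (Num.sqrt (2 * tau))
        (fun k => if k == x.1 then sgb x.2 * 2 else 0) | x : 'I_4 * bool]
  ++ [seq vec5 (Num.sqrt (2 * tau)) (fun k => sgb (e k)) | e : {ffun 'I_4 -> bool}].

Definition wbase (e : bool * bool * bool) (k : 'I_4) : R :=
  nth 0 [:: sgb e.1.1 * tau; sgb e.1.2; sgb e.2 * tau^-1; 0] k.

Definition normals96 : seq 'cV[R]_5 :=
  [seq vec5 (Num.sqrt (2 * tau)) (fun k => wbase x.1 (x.2 k))
  | x : (bool * bool * bool) * {perm 'I_4} <- enum [pred x : (bool * bool * bool) * {perm 'I_4} | ~~ odd_perm x.2]].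

Definition nrm (j : 'I_96) : 'cV[R]_5 := nth 0 normals96 j.

(* the 120-cell P: bounded by all 120 hyperplanes, on the side containing
   the center (1,0,0,0,0) *)
Definition inP (x : 'cV[R]_5) : Prop :=
  inH4 x /\ (forall n, n \in normalsC ++ normals96 -> mink x n <= 0).

Definition walls_meet (i j : 'I_96) : Prop :=
  i != j /\ exists x, [/\ inP x, mink x (nrm i) = 0 & mink x (nrm j) = 0].

Definition reflection (n : 'cV[R]_5) : 'M[R]_5 :=
  1%:M - (2 / mink n n) *: (n *m (n^T *m Mmink)).

Definition Vpt := 'I_96 -> 'M[R]_5.

(* the inclusion representation Gamma -> G_4 *)
Definition rho0 : Vpt := fun j => reflection (nrm j).

(* the polynomial equations P_alpha (matrix-valued, each entry is one P_alpha) *)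
Definition eqO (j : 'I_96) (X : Vpt) : 'M[R]_5 := (X j)^T *m Mmink *m X j - Mmink.
Definition eqR (j : 'I_96) (X : Vpt) : 'M[R]_5 := X j *m X j - 1%:M.
Definition eqC (i j : 'I_96) (X : Vpt) : 'M[R]_5 :=
  X i *m X j *m X i *m X j - 1%:M.

Definition smooth_on (e : R) (f : R -> R) : Prop :=
  forall (n : nat) (x : R), - e < x < e -> derivable (derive1n n f) x 1.

Definition smooth_path (e : R) (p : R -> Vpt) : Prop :=
  forall j a b, smooth_on e (fun t => p t j a b).

Definition tangent_at0 (p : R -> Vpt) (v : Vpt) : Prop :=
  forall j a b, derive1 (fun t => p t j a b) 0 = v j a b.

Definition dvanish (F : Vpt -> 'M[R]_5) (p : R -> Vpt) : Prop :=
  forall a b, derive1 (fun t => F (p t) a b) 0 = 0.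

Definition inf_deformation (rho v : Vpt) : Prop :=
  exists e : R, exists p : R -> Vpt,
    [/\ 0 < e, smooth_path e p, p 0 = rho, tangent_at0 p v &
      [/\ forall j, dvanish (eqO j) p,
          forall j, dvanish (eqR j) p &
          forall i j, walls_meet i j -> dvanish (eqC i j) p]].

Definition in_orbit (rho X : Vpt) : Prop :=
  exists g, inG4 g /\ X = (fun j => g *m rho j *m invmx g).

Definition inf_conjugation (rho v : Vpt) : Prop :=
  exists e : R, exists p : R -> Vpt,
    [/\ 0 < e, smooth_path e p, p 0 = rho, tangent_at0 p v &
        forall t, - e < t < e -> in_orbit rho (p t)].

Definition inf_rigid (rho : Vpt) : Prop :=
  forall v, inf_deformation rho v -> inf_conjugation rho v.

End Defs.

(* Main.v *)
(* The idea is that a tangent vector at the inclusion amounts to a velocity for each unit normal, and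
   that eliminating the time coordinates turns the linearised commutation relations into the
   statement that a velocity field on the 96 normals, seen as the vertices of the snub 24-cell in
   R^4, preserves to first order the lengths of the edges.  So the claim is the infinitesimal
   rigidity of that bar framework.  As in the theorems of Cauchy-Dehn and Alexandrov, the icosahedral
   facets are rigid inside their hyperplanes: an explicit self-stress shows that each short diagonal
   of an icosahedron also keeps its length.  Two further self-stresses supported in vertex figures
   then provide enough bars to attach all vertices, one after the other, by four independent bars,
   to a rigid simplex.  All this is arithmetic in Z[tau].  Conversely, an element of so(1,4) is
   integrated to a smooth path in G_4, a product of one-parameter groups of rotations and boosts. *)
From Stdlib Require Import ZArith.
From HB Require Import structures.
From mathcomp Require Import all_boot all_order all_algebra all_fingroup.
From mathcomp Require Import ssrZ ring lra.
From mathcomp Require Import all_classical all_reals all_analysis.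
Require Import Defs.
Set Implicit Arguments. Unset Strict Implicit. Unset Printing Implicit Defensive.
Import Order.TTheory GRing.Theory Num.Theory.
Local Open Scope ring_scope.
Delimit Scope Z_scope with ZZ.

(** * Computing in Z[tau] *)

(* [(a, b)] stands for [a + b tau]. *)
Definition ztau : Type := Z * Z.

Definition zt0 : ztau := (0%ZZ, 0%ZZ).
Definition zt_add (x y : ztau) : ztau := ((x.1 + y.1)%ZZ, (x.2 + y.2)%ZZ).
Definition zt_opp (x : ztau) : ztau := ((- x.1)%ZZ, (- x.2)%ZZ).
Definition zt_sub (x y : ztau) : ztau := ((x.1 - y.1)%ZZ, (x.2 - y.2)%ZZ).
Definition zt_mul (x y : ztau) : ztau :=
  ((x.1 * y.1 + x.2 * y.2)%ZZ, (x.1 * y.2 + x.2 * y.1 + x.2 * y.2)%ZZ).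
Definition zt_eq (x y : ztau) : bool := Z.eqb x.1 y.1 && Z.eqb x.2 y.2.
(* The algebraic norm of [x] does not vanish. *)
Definition zt_neq0 (x : ztau) : bool :=
  negb (Z.eqb (x.1 * x.1 + x.1 * x.2 - x.2 * x.2)%ZZ 0%ZZ).

Definition zvec : Type := seq ztau.

Definition zv_sub (x y : zvec) : zvec :=
  mkseq (fun k => zt_sub (nth zt0 x k) (nth zt0 y k)) 4.
Definition zv_add (x y : zvec) : zvec :=
  mkseq (fun k => zt_add (nth zt0 x k) (nth zt0 y k)) 4.
Definition zv_scale (c : ztau) (x : zvec) : zvec :=
  mkseq (fun k => zt_mul c (nth zt0 x k)) 4.
Definition zv0 : zvec := nseq 4 zt0.
Definition zv_eq (x y : zvec) : bool :=
  all (fun k => zt_eq (nth zt0 x k) (nth zt0 y k)) (iota 0 4).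
Definition zv_dot (x y : zvec) : ztau :=
  let c k := zt_mul (nth zt0 x k) (nth zt0 y k) in
  zt_add (c 0%N) (zt_add (c 1%N) (zt_add (c 2%N) (c 3%N))).

(** Abstract over the operations, so that one formula serves both [ztau], where it is computed, and
    the reals, where it is interpreted. [det3] is the minor on the columns [a], [b], [c]. *)
Definition det3 (T : Type) (add sub mul : T -> T -> T) (x y z : nat -> T) (a b c : nat) : T :=
  let m i j := sub (mul (y i) (z j)) (mul (y j) (z i)) in
  add (sub (mul (x a) (m b c)) (mul (x b) (m a c))) (mul (x c) (m a b)).
Definition det4 (T : Type) (add sub mul : T -> T -> T) (w x y z : nat -> T) : T :=
  let m := det3 add sub mul x y z in
  sub (add (sub (mul (w 0) (m 1 2 3)) (mul (w 1) (m 0 2 3))) (mul (w 2) (m 0 1 3)))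
      (mul (w 3) (m 0 1 2)).
Definition zv_det (w x y z : zvec) : ztau :=
  det4 zt_add zt_sub zt_mul (nth zt0 w) (nth zt0 x) (nth zt0 y) (nth zt0 z).

(** * The vertices of the snub 24-cell *)

Definition swap (a b k : nat) : nat := if k == a then b else if k == b then a else k.

Definition word : Type := (nat * nat) * (nat * nat).

(* Each even permutation of four letters, as a product of two transpositions. *)
Definition words : seq word :=
  [:: ((0, 1), (0, 1)); ((1, 2), (1, 3)); ((1, 2), (2, 3)); ((0, 1), (2, 3));
      ((0, 1), (0, 2)); ((0, 1), (0, 3)); ((0, 1), (1, 2)); ((0, 2), (0, 3));
      ((0, 2), (1, 3)); ((0, 1), (1, 3)); ((0, 2), (2, 3)); ((0, 3), (1, 2))]%N.
Definition word_fun (l : word) (k : nat) : nat := swap l.2.1 l.2.2 (swap l.1.1 l.1.2 k).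

Definition label : Type := word * (bool * bool * bool).

Definition zt_sign (b : bool) (x : ztau) : ztau := if b then x else zt_opp x.
(** The pair [(-1, 1)] is [tau - 1], the inverse of [tau]. *)
Definition base_coord (e : bool * bool * bool) (k : nat) : ztau :=
  nth zt0 [:: zt_sign e.1.1 (0, 1)%ZZ; zt_sign e.1.2 (1, 0)%ZZ; zt_sign e.2 (-1, 1)%ZZ; zt0] k.
Definition vertex (x : label) : zvec := mkseq (fun k => base_coord x.2 (word_fun x.1 k)) 4.

Definition signs : seq (bool * bool * bool) :=
  [seq (ab, c) | ab <- [seq (a, b) | a <- [:: true; false], b <- [:: true; false]],
                 c <- [:: true; false]].
Definition labels : seq label := [seq (l, e) | l <- words, e <- signs].
Definition label0 : label := (((0, 1), (0, 1))%N, (true, true, true)).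
Definition lab (i : nat) : label := nth label0 labels i.

Definition vertices : seq zvec := [seq vertex x | x <- labels].
Definition vtx (i : nat) : zvec := nth (vertex label0) vertices i.

(* The vertices of the 24-cell, which are the centres of the 24 icosahedra. *)
Definition centers : seq zvec :=
  [seq mkseq (fun i => if i == k then (c, 0%ZZ) else zt0) 4
     | k <- iota 0 4, c <- [:: 2%ZZ; (-2)%ZZ]] ++
  let pm := [:: (1, 0)%ZZ; (-1, 0)%ZZ] in
  [seq x ++ y | x <- [seq [:: a; b] | a <- pm, b <- pm],
                y <- [seq [:: a; b] | a <- pm, b <- pm]].

Definition zt_2tau : ztau := (0, 2)%ZZ.
(** The time coordinates of two normals contribute [- 2 tau] to their Minkowski product, so an edge
    is a pair of orthogonal normals. *)
Definition edge (i j : nat) : bool := zt_eq (zv_dot (vtx i) (vtx j)) zt_2tau.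

(** * Self-stresses *)

(* A list of weighted bars; the first one is the bar whose length is controlled by the others. *)
Definition stress : Type := seq (nat * nat * ztau).

Definition stress_verts (st : stress) : seq nat :=
  undup ([seq b.1.1 | b <- st] ++ [seq b.1.2 | b <- st]).

Definition force (st : stress) (v : nat) : zvec :=
  foldr (fun b f =>
    let d := zv_scale b.2 (zv_sub (vtx b.1.1) (vtx b.1.2)) in
    let f1 := if b.1.1 == v then zv_add d f else f in
    if b.1.2 == v then zv_sub f1 d else f1) zv0 st.

Definition self_stress (st : stress) : bool :=
  all (fun v => zv_eq (force st v) zv0) (stress_verts st).

(* Dot products of vertices of an icosahedron with circumcentre in [centers], by increasing distance. *)
Definition level (i j : nat) : nat :=
  find (zt_eq (zv_dot (vtx i) (vtx j))) [:: (4, 0); (0, 2); (2, 0); (-2, 2)]%ZZ.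

(* For a short diagonal [a b] of an icosahedron, the unique self-stress supported on the edges and
   [a b], normalised to be 20 on [a b]; the weight of the edge [x y] only depends on the distances
   from [x] and [y] to [a] and [b], up to exchanging [x] and [y]. *)
Definition ico_weight (a b x y : nat) : ztau :=
  let p := (level x a, level x b) in let q := (level y a, level y b) in
  let fix look t := match t with
    | [::] => zt0
    | (p', q', c) :: t' =>
        if ((p == p') && (q == q')) || ((p == q') && (q == p')) then c else look t'
    end in
  look [:: ((0, 2), (1, 3), (2, -4)%ZZ); ((0, 2), (1, 2), (-8, 1)%ZZ);
           ((0, 2), (1, 1), (-3, -9)%ZZ); ((1, 3), (1, 2), (2, 1)%ZZ);
           ((1, 3), (2, 2), (-3, 1)%ZZ); ((2, 0), (3, 1), (2, -4)%ZZ);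
           ((2, 0), (2, 1), (-8, 1)%ZZ); ((2, 0), (1, 1), (-3, -9)%ZZ);
           ((3, 1), (2, 1), (2, 1)%ZZ); ((3, 1), (2, 2), (-3, 1)%ZZ);
           ((1, 2), (2, 1), (2, -4)%ZZ); ((1, 2), (1, 1), (-3, 6)%ZZ);
           ((1, 2), (2, 2), (7, -4)%ZZ); ((2, 1), (1, 1), (-3, 6)%ZZ);
           ((2, 1), (2, 2), (7, -4)%ZZ); ((1, 1), (1, 1), (12, 6)%ZZ);
           ((2, 2), (2, 2), (-8, 6)%ZZ)]%N.

(** An icosahedron consists of the vertices whose dot product with its centre [c] is [2 tau]; here
    [c] is the first centre whose icosahedron contains both ends of the diagonal. *)
Definition ico_stress (ab : nat * nat) : stress :=
  let at_edge c i := zt_eq (zv_dot (vtx i) c) zt_2tau in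
  let c := nth zv0 centers (find (fun c => at_edge c ab.1 && at_edge c ab.2) centers) in
  let ico := [seq i <- iota 0 96 | at_edge c i] in
  (ab.1, ab.2, (20, 0)%ZZ) ::
  [seq (x, y, ico_weight ab.1 ab.2 x y)
     | x <- ico, y <- [seq y <- ico | (x < y)%N && edge x y]].

Definition short_diagonals : seq (nat * nat) :=
  [:: (0, 2); (0, 18); (0, 40); (0, 44); (0, 64); (1, 16); (1, 68); (2, 40); (2, 64); (3, 41);
      (3, 68); (3, 86); (4, 13); (4, 57); (5, 75); (8, 90); (10, 36); (11, 37); (16, 24);
      (16, 58); (17, 25); (18, 24); (18, 58); (18, 90); (36, 69); (38, 43); (40, 90);
      (41, 43); (41, 88); (56, 58); (58, 68); (58, 86); (58, 90); (59, 69); (59, 86);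
      (59, 90)]%N.

(** These make the bars 18 40 and 86 90 available. The weights solve the equilibrium equations,
    which [extra_bars_controlled] verifies. *)
Definition extra_stresses : seq stress :=
  [:: [:: (18, 40, (2, 0)%ZZ); (18, 58, (1, -1)%ZZ); (8, 40, (0, -1)%ZZ);
          (40, 58, (-1, 0)%ZZ); (40, 56, (-1, 0)%ZZ); (56, 90, (1, -1)%ZZ);
          (9, 18, (-1, 0)%ZZ); (8, 18, (0, -1)%ZZ); (9, 40, (0, -1)%ZZ); (8, 90, (-1, 1)%ZZ);
          (8, 9, (0, 1)%ZZ); (9, 58, (1, 0)%ZZ); (56, 58, (-1, 1)%ZZ); (18, 90, (-2, 1)%ZZ)];
      [:: (86, 90, (2, 0)%ZZ); (68, 90, (0, -1)%ZZ); (69, 90, (0, -1)%ZZ);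
          (58, 68, (-1, 1)%ZZ); (58, 90, (-2, 1)%ZZ); (69, 86, (0, -1)%ZZ);
          (59, 86, (-2, 1)%ZZ); (58, 59, (2, -1)%ZZ); (59, 90, (-2, 1)%ZZ);
          (68, 69, (0, 1)%ZZ); (58, 86, (-2, 1)%ZZ); (59, 69, (-1, 1)%ZZ);
          (68, 86, (0, -1)%ZZ)]]%N.

Definition bar_in (s : seq (nat * nat)) (i j : nat) : bool :=
  edge i j || (((i, j) \in s) || ((j, i) \in s)).

(** An equilibrium stress does no work, so if all other bars keep their length to first order, so
    does the leading one, its weight being nonzero. *)
Definition controls (s : seq (nat * nat)) (st : stress) : bool :=
  if st is b :: st' then
    [&& zt_neq0 b.2, all (fun b => bar_in s b.1.1 b.1.2) st' & self_stress st]
  else false.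

Definition extra_bars : seq (nat * nat) := [seq (head (0, 0, zt0)%N st).1 | st <- extra_stresses].

Definition all_bars : seq (nat * nat) := short_diagonals ++ extra_bars.

Lemma short_diagonals_controlled :
  all (fun ab => controls [::] (ico_stress ab)) short_diagonals.
Proof. by vm_compute. Qed.

Lemma extra_bars_controlled : all (controls short_diagonals) extra_stresses.
Proof. by vm_compute. Qed.

(** * Propagation from a simplex *)

Definition independent (i : nat) (ks : seq nat) : bool :=
  let d k := zv_sub (vtx i) (vtx (nth 0%N ks k)) in
  zt_neq0 (zv_det (d 0%N) (d 1%N) (d 2%N) (d 3%N)).

(** Five affinely independent vertices, any two of them joined by a bar; [simplex_ok] checks both
    properties. *)
Definition simplex : nat * seq nat := (16, [:: 0; 8; 1; 24])%N.

Definition simplex_ok : bool :=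
  let s := simplex.1 :: simplex.2 in
  independent simplex.1 simplex.2 &&
  all (fun i => all (fun j => (i == j) || bar_in all_bars i j) s) s.

(* [(i, ks)]: the vertex [i] is attached by four independent bars to vertices [ks] that come before. *)
Definition attachments : seq (nat * seq nat) :=
  [:: (18, [:: 1; 8; 0; 24]); (40, [:: 8; 16; 0; 18]); (9, [:: 8; 16; 18; 40]);
      (41, [:: 8; 9; 18; 40]); (56, [:: 8; 24; 40; 41]); (58, [:: 9; 40; 41; 16]);
      (2, [:: 9; 16; 0; 40]); (3, [:: 2; 9; 18; 41]); (28, [:: 2; 3; 9; 58]);
      (64, [:: 16; 40; 0; 2]); (88, [:: 40; 56; 64; 41]); (89, [:: 40; 58; 64; 88]);
      (68, [:: 18; 41; 1; 3]); (90, [:: 41; 56; 68; 40]); (91, [:: 41; 58; 68; 90]);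
      (86, [:: 68; 91; 3; 90]); (69, [:: 68; 86; 90; 91]); (36, [:: 1; 18; 68; 69]);
      (19, [:: 1; 3; 18; 36]); (37, [:: 3; 18; 19; 36]); (84, [:: 36; 68; 69; 90]);
      (10, [:: 0; 1; 19; 36]); (25, [:: 0; 1; 10; 24]); (50, [:: 1; 24; 25; 36]);
      (11, [:: 2; 3; 10; 37]); (29, [:: 2; 3; 11; 28]); (54, [:: 3; 28; 29; 37]);
      (17, [:: 0; 2; 10; 25]); (32, [:: 0; 16; 17; 64]); (33, [:: 2; 16; 17; 32]);
      (48, [:: 0; 24; 25; 32]); (52, [:: 2; 28; 29; 33]); (43, [:: 69; 90; 91; 41]);
      (44, [:: 10; 11; 17; 0]); (45, [:: 10; 11; 19; 44]); (60, [:: 10; 25; 44; 45]);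
      (62, [:: 11; 29; 44; 45]); (66, [:: 17; 32; 33; 44]); (70, [:: 19; 36; 37; 45]);
      (85, [:: 36; 50; 70; 84]); (87, [:: 37; 54; 70; 86]); (38, [:: 69; 84; 85; 43]);
      (51, [:: 38; 50; 84; 85]); (73, [:: 24; 50; 51; 56]); (57, [:: 43; 56; 73; 88]);
      (72, [:: 24; 48; 56; 57]); (26, [:: 51; 57; 72; 73]); (75, [:: 25; 50; 51; 60]);
      (74, [:: 25; 48; 60; 75]); (5, [:: 26; 38; 51; 75]); (27, [:: 5; 26; 51; 74]);
      (61, [:: 27; 60; 74; 75]); (92, [:: 44; 60; 61; 66]); (93, [:: 44; 62; 66; 92]);
      (94, [:: 45; 60; 61; 70]); (71, [:: 38; 70; 85; 94]); (95, [:: 45; 62; 70; 71]);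
      (47, [:: 61; 71; 94; 95]); (4, [:: 5; 26; 27; 57]); (12, [:: 4; 5; 26; 43]);
      (14, [:: 4; 5; 27; 47]); (42, [:: 12; 43; 57; 88]); (46, [:: 14; 47; 61; 92]);
      (49, [:: 4; 26; 27; 48]); (65, [:: 42; 64; 88; 89]); (67, [:: 46; 66; 92; 93]);
      (34, [:: 4; 49; 65; 67]); (80, [:: 32; 34; 48; 64]); (81, [:: 32; 34; 48; 66]);
      (82, [:: 33; 52; 64; 65]); (83, [:: 33; 52; 66; 67]); (13, [:: 12; 42; 43; 4]);
      (20, [:: 4; 12; 13; 34]); (21, [:: 4; 14; 20; 34]); (15, [:: 14; 21; 46; 47]);
      (22, [:: 5; 12; 13; 38]); (23, [:: 5; 14; 15; 38]); (35, [:: 20; 21; 34; 65]);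
      (6, [:: 13; 15; 20; 35]); (39, [:: 22; 23; 38; 69]); (7, [:: 6; 13; 15; 39]);
      (53, [:: 6; 35; 52; 82]); (30, [:: 6; 7; 13; 53]); (31, [:: 6; 7; 15; 30]);
      (55, [:: 7; 30; 31; 39]); (59, [:: 13; 30; 42; 43]); (63, [:: 15; 31; 46; 47]);
      (76, [:: 28; 30; 52; 58]); (77, [:: 28; 30; 54; 58]); (78, [:: 29; 31; 52; 62]);
      (79, [:: 29; 31; 54; 62])]%N.

(** [known] collects the vertices already placed; the final test is that all 96 have been
    reached. *)
Fixpoint attachable (known : seq nat) (s : seq (nat * seq nat)) : bool :=
  if s is (i, ks) :: s' then
    [&& size ks == 4, all (fun k => (k \in known) && bar_in all_bars i k) ks,
        independent i ks & attachable (i :: known) s']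
  else all (fun i => i \in known) (iota 0 96).

Lemma simplex_rigid : simplex_ok.
Proof. by vm_compute. Qed.

Lemma attachments_ok : attachable (simplex.1 :: simplex.2) attachments.
Proof. by vm_compute. Qed.

(* Distinct walls meet at dot product [2 tau] and are disjoint below that. *)
Definition dot_values : seq ztau :=
  [:: (-4, 0); (0, -2); (-2, 0); (2, -2); (0, 0); (-2, 2); (2, 0); (0, 2)]%ZZ.

(** Both kinds of normals are compared with the vertices, because a point common to two walls must
    lie on the inner side of all 120 hyperplanes. *)
Lemma dots_small :
  all (fun x => all (fun y => has (zt_eq (zv_dot x y)) dot_values || zv_eq x y)
                    (centers ++ vertices)) vertices.
Proof. by vm_compute. Qed.

(** * Evaluation in the reals and rigidity of the framework *)

Lemma int_of_ZD x y : int_of_Z (Z.add x y) = int_of_Z x + int_of_Z y.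
Proof. exact: rmorphD. Qed.
Lemma int_of_ZN x : int_of_Z (Z.opp x) = - int_of_Z x.
Proof. exact: rmorphN. Qed.
Lemma int_of_ZB x y : int_of_Z (Z.sub x y) = int_of_Z x - int_of_Z y.
Proof. exact: rmorphB. Qed.
Lemma int_of_ZM x y : int_of_Z (Z.mul x y) = int_of_Z x * int_of_Z y.
Proof. exact: rmorphM. Qed.
Definition int_of_ZE := (int_of_ZD, int_of_ZN, int_of_ZB, int_of_ZM).

Lemma cramer4 (R : idomainType) (w x y z v : nat -> R) :
  let dot u := u 0%N * v 0%N + u 1%N * v 1%N + u 2%N * v 2%N + u 3%N * v 3%N in
  det4 +%R (fun a b => a - b) *%R w x y z != 0 ->
  dot w = 0 -> dot x = 0 -> dot y = 0 -> dot z = 0 ->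
  [/\ v 0%N = 0, v 1%N = 0, v 2%N = 0 & v 3%N = 0].
Proof.
move=> dot hdet hw hx hy hz.
pose m := det3 +%R (fun a b : R => a - b) *%R.
(* Cramer's rule by cofactors: [a], [b], [c] are the columns other than [k], in increasing order. *)
have H a b c k : det4 +%R (fun a b => a - b) *%R w x y z * v k =
    (dot w * m x y z a b c - dot x * m w y z a b c
     + dot y * m w x z a b c - dot z * m w x y a b c) * (-1) ^+ odd k -> v k = 0.
  rewrite hw hx hy hz !mul0r !subr0 addr0 mul0r => /eqP.
  by rewrite mulf_eq0 (negPf hdet) => /eqP.
split; [apply: (H 1 2 3)%N | apply: (H 0 2 3)%N | apply: (H 0 1 3)%N | apply: (H 0 1 2)%N];
  rewrite /m /dot /det4 /det3 /= ?expr1 ?expr0; ring.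
Qed.

Section Evaluation.
Variable R : realType.
Local Notation tau := (tau R).

Lemma tau_sqr : tau * tau = tau + 1.
Proof.
have h : Num.sqrt 5 * Num.sqrt 5 = 5 :> R by rewrite -expr2 sqr_sqrtr // ler0n.
by rewrite /Defs.tau; move: (Num.sqrt 5) h => r h; field: h.
Qed.

Lemma tau_bounds : 1 < tau < 2.
Proof.
have h : Num.sqrt 5 * Num.sqrt 5 = 5 :> R by rewrite -expr2 sqr_sqrtr // ler0n.
have h0 : 0 <= Num.sqrt 5 :> R by exact: sqrtr_ge0.
rewrite /Defs.tau; move: (Num.sqrt 5) h h0 => r h h0.
by apply/andP; split; nra.
Qed.

Lemma tau_inv : tau^-1 = tau - 1.
Proof.
have /andP[h _] := tau_bounds; have h0 : tau != 0 by lra.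
by apply: (mulfI h0); rewrite mulfV // mulrBr tau_sqr; ring.
Qed.

Definition zt_eval (x : ztau) : R := (int_of_Z x.1)%:~R + (int_of_Z x.2)%:~R * tau.

Lemma zt_evalD x y : zt_eval (zt_add x y) = zt_eval x + zt_eval y.
Proof. by rewrite /zt_eval /= !int_of_ZE !rmorphD /=; ring. Qed.

Lemma zt_evalN x : zt_eval (zt_opp x) = - zt_eval x.
Proof. by rewrite /zt_eval /= !int_of_ZE !rmorphN /=; ring. Qed.

Lemma zt_evalB x y : zt_eval (zt_sub x y) = zt_eval x - zt_eval y.
Proof. by rewrite /zt_eval /= !int_of_ZE !rmorphB /=; ring. Qed.

Lemma zt_evalM x y : zt_eval (zt_mul x y) = zt_eval x * zt_eval y.
Proof.
rewrite /zt_eval /= !int_of_ZE !rmorphD !rmorphM /=.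
have := tau_sqr; move: tau => t h; ring: h.
Qed.

Lemma zt_eval0 : zt_eval zt0 = 0.
Proof. by rewrite /zt_eval /= mul0r addr0. Qed.

Lemma zt_eq_eval x y : zt_eq x y -> zt_eval x = zt_eval y.
Proof. by case: x y => a b [c d] /andP[/= /Z.eqb_eq -> /Z.eqb_eq ->]. Qed.

(** The norm is the product of the value and its conjugate, so it vanishes with the value. *)
Lemma zt_neq0_eval x : zt_neq0 x -> zt_eval x != 0.
Proof.
case: x => u v h; apply/eqP => h0; move: h; rewrite /zt_neq0 => /negP; apply.
apply/Z.eqb_eq; apply: (can_inj int_of_ZK); apply/eqP; rewrite -(intr_eq0 R).
rewrite !int_of_ZE !(rmorphB, rmorphD, rmorphM) /=; move: h0; rewrite /zt_eval /=.
have := tau_sqr; move: tau (int_of_Z u)%:~R (int_of_Z v)%:~R => t a b h h0.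
apply/eqP; have -> : a = - (b * t) by lra.
ring: h.
Qed.

(** * Vectors of R^4 and their dot product *)

Definition dotp (x y : 'rV[R]_4) : R := \sum_k x 0 k * y 0 k.

Lemma dotpC x y : dotp x y = dotp y x.
Proof. by apply: eq_bigr => k _; rewrite mulrC. Qed.
Lemma dotpDl x y z : dotp (x + y) z = dotp x z + dotp y z.
Proof. by rewrite -big_split; apply: eq_bigr => k _; rewrite mxE mulrDl. Qed.
Lemma dotpNl x z : dotp (- x) z = - dotp x z.
Proof. by rewrite -sumrN; apply: eq_bigr => k _; rewrite mxE mulNr. Qed.
Lemma dotpZl c x z : dotp (c *: x) z = c * dotp x z.
Proof. by rewrite mulr_sumr; apply: eq_bigr => k _; rewrite mxE mulrA. Qed.
Lemma dotpBl x y z : dotp (x - y) z = dotp x z - dotp y z.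
Proof. by rewrite dotpDl dotpNl. Qed.
Lemma dotpDr x y z : dotp z (x + y) = dotp z x + dotp z y.
Proof. by rewrite dotpC dotpDl !(dotpC z). Qed.
Lemma dotpBr x y z : dotp z (x - y) = dotp z x - dotp z y.
Proof. by rewrite dotpC dotpBl !(dotpC z). Qed.
Lemma dotpZr c x z : dotp z (c *: x) = c * dotp z x.
Proof. by rewrite dotpC dotpZl dotpC. Qed.
Lemma dotp0r z : dotp z 0 = 0.
Proof. by rewrite -(scale0r 0) dotpZr mul0r. Qed.
Lemma dotp_sumr (I : Type) (s : seq I) (f : I -> 'rV[R]_4) z :
  dotp z (\sum_(b <- s) f b) = \sum_(b <- s) dotp z (f b).
Proof. by elim/big_rec2: _ => [|i x y _ <-]; rewrite ?dotp0r ?dotpDr. Qed.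
Lemma dotpE x y : dotp x y = (x *m y^T) 0 0.
Proof. by rewrite mxE; apply: eq_bigr => k _; rewrite mxE. Qed.
Lemma dotp_mulmx x y (S : 'M[R]_4) : dotp (x *m S) y = dotp x (y *m S^T).
Proof. by rewrite !dotpE trmx_mul trmxK mulmxA. Qed.

Lemma dotp_skew x (S : 'M[R]_4) : S^T = - S -> dotp (x *m S) x = 0.
Proof.
move=> hS; have h : dotp (x *m S) x = - dotp (x *m S) x.
  by rewrite {1}dotp_mulmx hS mulmxN dotpC dotpNl.
lra.
Qed.

Definition zv_eval (x : zvec) : 'rV[R]_4 := \row_k zt_eval (nth zt0 x k).

Lemma zv_evalB x y : zv_eval (zv_sub x y) = zv_eval x - zv_eval y.
Proof. by apply/rowP => k; rewrite !mxE nth_mkseq // zt_evalB. Qed.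
Lemma zv_evalD x y : zv_eval (zv_add x y) = zv_eval x + zv_eval y.
Proof. by apply/rowP => k; rewrite !mxE nth_mkseq // zt_evalD. Qed.
Lemma zv_evalZ c x : zv_eval (zv_scale c x) = zt_eval c *: zv_eval x.
Proof. by apply/rowP => k; rewrite !mxE nth_mkseq // zt_evalM. Qed.
Lemma zv_eval0 : zv_eval zv0 = 0.
Proof. by apply/rowP => k; rewrite !mxE nth_nseq ltn_ord zt_eval0. Qed.
Lemma zv_eq_eval x y : zv_eq x y -> zv_eval x = zv_eval y.
Proof.
move=> /allP h; apply/rowP => k; rewrite !mxE; apply: zt_eq_eval.
by have := h k; rewrite mem_iota; apply; exact: ltn_ord.
Qed.

Lemma zv_eval_dot x y : zt_eval (zv_dot x y) = dotp (zv_eval x) (zv_eval y).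
Proof.
by rewrite /dotp !big_ord_recr big_ord0 /= !mxE /zv_dot !zt_evalD !zt_evalM /= add0r !addrA.
Qed.

Lemma zv_det_inj (d : nat -> zvec) (y : 'rV[R]_4) :
  zt_neq0 (zv_det (d 0%N) (d 1%N) (d 2%N) (d 3%N)) ->
  (forall k, (k < 4)%N -> dotp y (zv_eval (d k)) = 0) -> y = 0.
Proof.
move=> /zt_neq0_eval hdet h.
pose r i k := zt_eval (nth zt0 (d i) k).
have hr i : (i < 4)%N -> r i 0%N * y 0 (inord 0) + r i 1%N * y 0 (inord 1)
    + r i 2%N * y 0 (inord 2) + r i 3%N * y 0 (inord 3) = 0.
  move=> /h; rewrite /dotp => <-; rewrite (eq_bigr (fun k : 'I_4 => r i k * y 0 (inord k))).
    by rewrite !big_ord_recr big_ord0 /= add0r.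
  by move=> k _; rewrite inord_val mxE mulrC.
have [//|//|//|//||] := @cramer4 R (r 0%N) (r 1%N) (r 2%N) (r 3%N) (fun k => y 0 (inord k));
  rewrite ?hr //.
  by move: hdet; rewrite /zv_det /det4 /det3 !(zt_evalB, zt_evalD, zt_evalM).
move=> h0 h1 h2 h3; apply/rowP => k; rewrite mxE -[k]inord_val.
by case: k => [[|[|[|[|]]]]].
Qed.

(** * Infinitesimal rigidity of the framework under velocities [z] *)

Section Framework.
Variable z : nat -> 'rV[R]_4.

Local Notation W i := (zv_eval (vtx i)).

(** The product is half the derivative of the squared length of the bar. *)
Definition preserved (i j : nat) : Prop := dotp (z i - z j) (W i - W j) = 0.

Lemma preservedC i j : preserved i j -> preserved j i.
Proof.
have opp (x y : 'rV[R]_4) : y - x = -1 *: (x - y) by rewrite scaleN1r opprB.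
by rewrite /preserved => h; rewrite (opp (z i)) (opp (W i)) dotpZl dotpZr h !mulr0.
Qed.

Lemma zv_eval_force st v :
  zv_eval (force st v) =
  \sum_(b <- st) (zt_eval b.2 * ((b.1.1 == v)%:R - (b.1.2 == v)%:R)) *: (W b.1.1 - W b.1.2).
Proof.
elim: st => [|[[i j] c] st IH] /=; first by rewrite big_nil zv_eval0.
rewrite big_cons -IH /=; case: (i == v) (j == v) => [] [];
  rewrite ?(zv_evalB, zv_evalD, zv_evalZ);
  move: (zv_eval (force st v)) (W i) (W j) => f wi wj;
  apply/rowP => k; rewrite !mxE /=; ring.
Qed.

Lemma sum_seq_pick (s : seq nat) (i : nat) (f : nat -> R) :
  uniq s -> i \in s -> \sum_(v <- s) (i == v)%:R * f v = f i.
Proof.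
move=> us si; rewrite (bigD1_seq i) //= eqxx mul1r big1 ?addr0 // => v.
by rewrite eq_sym => /negPf ->; rewrite mul0r.
Qed.

(* Virtual work: an equilibrium stress does no work. *)
Lemma self_stress_work st : self_stress st ->
  \sum_(b <- st) zt_eval b.2 * dotp (z b.1.1 - z b.1.2) (W b.1.1 - W b.1.2) = 0.
Proof.
move=> /allP hst; pose s := stress_verts st.
(* The work is regrouped by vertices: a bar exerts opposite forces at its two ends. *)
transitivity (\sum_(v <- s) dotp (z v) (zv_eval (force st v))); last first.
  by rewrite big_seq big1 // => v /hst /zv_eq_eval ->; rewrite zv_eval0 dotp0r.
have mems b : b \in st -> (b.1.1 \in s) && (b.1.2 \in s).
  move=> hb; rewrite /s !mem_undup !mem_cat.
  rewrite (map_f (fun b : nat * nat * ztau => b.1.1) hb).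
  by rewrite (map_f (fun b : nat * nat * ztau => b.1.2) hb) orbT.
under [RHS]eq_bigr => v _.
  rewrite zv_eval_force dotp_sumr. over.
rewrite exchange_big /= big_seq [RHS]big_seq; apply: eq_bigr => b /mems /andP[h1 h2].
rewrite dotpBl mulrBr.
rewrite -(sum_seq_pick (fun v => zt_eval b.2 * dotp (z v) (W b.1.1 - W b.1.2)) (undup_uniq _) h1).
rewrite -(sum_seq_pick (fun v => zt_eval b.2 * dotp (z v) (W b.1.1 - W b.1.2)) (undup_uniq _) h2).
by rewrite -sumrB; apply: eq_bigr => v _; rewrite dotpZr; ring.
Qed.

Definition preserves (s : seq (nat * nat)) : Prop := {in s, forall b, preserved b.1 b.2}.

Hypothesis edges_preserved : forall i j, edge i j -> preserved i j.

Lemma bar_in_preserved s i j : preserves s -> bar_in s i j -> preserved i j.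
Proof.
move=> hs /orP[/edges_preserved //|/orP[/hs //|/hs]].
exact: preservedC.
Qed.

Lemma controls_preserved s st : preserves s -> controls s st ->
  let b := head (0%N, 0%N, zt0) st in preserved b.1.1 b.1.2.
Proof.
move=> hs; case: st => [//|b st] /and3P[c0 /allP hst /self_stress_work].
rewrite big_cons big_seq big1 => [|d hd]; last first.
  by rewrite (_ : dotp _ _ = 0) ?mulr0 //; apply: bar_in_preserved hs (hst _ hd).
by move=> /eqP; rewrite addr0 mulf_eq0 (negPf (zt_neq0_eval c0)) => /eqP.
Qed.

Lemma short_diagonals_preserved : preserves short_diagonals.
Proof.
move=> b hb; apply: (@controls_preserved [::] (ico_stress b)) => //.
exact: (allP short_diagonals_controlled).
Qed.

Lemma all_bars_preserved : preserves all_bars.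
Proof.
move=> b; rewrite mem_cat => /orP[|/mapP[st hst ->]].
  exact: short_diagonals_preserved.
apply: controls_preserved short_diagonals_preserved _.
exact: (allP extra_bars_controlled).
Qed.

Definition motion (S : 'M[R]_4) (b : 'rV[R]_4) (i : nat) : Prop := z i = W i *m S + b.

Lemma independent_inj i ks (y : 'rV[R]_4) : independent i ks -> size ks = 4 ->
  {in ks, forall k, dotp y (W i - W k) = 0} -> y = 0.
Proof.
move=> hd sz h.
apply: (@zv_det_inj (fun k => zv_sub (vtx i) (vtx (nth 0%N ks k))) y hd) => k hk.
by rewrite zv_evalB; apply/h/mem_nth; rewrite sz.
Qed.

(** After subtraction of the motion, which preserves every bar by [dotp_skew], the remaining
    velocity of [i] is orthogonal to four independent bars, hence zero. *)
Lemma attach S b i ks : S^T = - S -> independent i ks -> size ks = 4 ->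
  {in ks, forall k, motion S b k /\ preserved i k} -> motion S b i.
Proof.
move=> hS ind sz h; apply/eqP; rewrite -subr_eq0; apply/eqP.
apply: (independent_inj ind sz) => k /h[hk]; rewrite /preserved.
have -> : z i - z k = (z i - (W i *m S + b)) + (W i - W k) *m S.
  rewrite hk mulmxBl; move: (W i *m S) (W k *m S) => p q.
  by apply/rowP => m; rewrite !mxE; ring.
by rewrite dotpDl dotp_skew // addr0.
Qed.

Lemma attachable_motion S b known s : S^T = - S -> attachable known s ->
  {in known, forall i, motion S b i} -> forall i, (i < 96)%N -> motion S b i.
Proof.
move=> hS; elim: s known => [|[i ks] s IH] known.
  move=> h hk i hi; have /allP/(_ i) : all (fun i => i \in known) (iota 0 96) := h.
  by rewrite mem_iota => /(_ hi)/hk.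
move=> /and4P[/eqP sz /allP hks ind /IH{}IH] hk; apply: IH => j.
rewrite inE => /predU1P[->|]; last exact: hk.
apply: attach hS ind sz _ => k /hks /andP[/hk mk hb]; split=> //.
exact: bar_in_preserved all_bars_preserved hb.
Qed.

(* The infinitesimal isometry is read off the velocities of the vertices of the simplex. *)
Lemma simplex_motion : exists S b,
  S^T = - S /\ {in simplex.1 :: simplex.2, forall i, motion S b i}.
Proof.
have /andP[ind /allP hb] := simplex_rigid.
have sz : size simplex.2 = 4 by [].
have pres i j : i \in simplex.1 :: simplex.2 -> j \in simplex.1 :: simplex.2 -> preserved i j.
  move=> hi hj; have /allP/(_ j hj)/orP[/eqP ->|] := hb i hi.
    by rewrite /preserved !subrr dotp0r.
  exact: bar_in_preserved all_bars_preserved.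
move: (simplex.1) (simplex.2) ind sz pres => o ks ind sz pres {hb}.
(* The rows are the differences from the apex [o], of positions in [D] and of velocities in [E]. The
   matrix sought solves [D S = E]. *)
pose d (f : nat -> 'rV[R]_4) := \matrix_(k < 4) (f o - f (nth 0%N ks k)).
pose D := d (fun i => W i); pose E := d z.
have hdot (f g : nat -> 'rV[R]_4) k l : (d f *m (d g)^T) k l =
    dotp (f o - f (nth 0%N ks k)) (g o - g (nth 0%N ks l)).
  by rewrite mxE; apply: eq_bigr => m _; rewrite !mxE.
have memk (k : 'I_4) : nth 0%N ks k \in o :: ks by rewrite inE mem_nth ?sz // orbT.
have uD : D \in unitmx.
  rewrite -unitmx_tr -row_free_unit -kermx_eq0; apply/rowV0P => y /sub_kermxP hy.
  apply: (independent_inj ind sz) => k hk.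
  have hi : (index k ks < 4)%N by have := hk; rewrite -index_mem sz.
  have := congr1 (fun m : 'rV_4 => m 0 (Ordinal hi)) hy; rewrite !mxE => <-.
  by apply: eq_bigr => m _; rewrite !mxE /= nth_index.
(* The three bars of the triangle on [o] and the vertices [k], [l] give skewness of [K] by
   polarisation. Then [S] is skew, being congruent to [- K]. *)
pose K := D *m E^T.
have skew : K^T = - K.
  apply/matrixP => k l; rewrite mxE [RHS]mxE !hdot.
  have := pres _ _ (memk k) (memk l); have := pres o _ (mem_head _ _) (memk l).
  have := pres o _ (mem_head _ _) (memk k); rewrite /preserved.
  move: (nth 0%N ks k) (nth 0%N ks l) => a c h1 h2.
  have -> : z a - z c = (z o - z c) - (z o - z a) by rewrite opprB [RHS]addrC subrKA.
  have -> : W a - W c = (W o - W c) - (W o - W a) by rewrite opprB [RHS]addrC subrKA.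
  rewrite !(dotpBl (_ - _)) !(dotpBr (_ - _)) h1 h2 => h3.
  by rewrite dotpC (dotpC (W o - W a)); lra.
pose S := invmx D *m E.
have hS : S^T = - S.
  have -> : S = - (invmx D *m K *m (invmx D)^T).
    rewrite -mulNmx -mulmxN -skew /K trmx_mul trmxK !mulmxA -/S.
    by rewrite -mulmxA -trmx_mul mulVmx // trmx1 mulmx1.
  by rewrite linearN /= trmx_mul trmxK trmx_mul skew mulNmx mulmxN mulmxA.
exists S, (z o - W o *m S); split=> // i.
have mo : motion S (z o - W o *m S) o by rewrite /motion addrC subrK.
rewrite inE => /predU1P[-> //|hi].
have hj : (index i ks < 4)%N by have := hi; rewrite -index_mem sz.
have : row (Ordinal hj) (D *m S) = row (Ordinal hj) E by rewrite mulKVmx.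
rewrite row_mul !rowK /= nth_index // mulmxBl => h.
by rewrite /motion -[z i](subKr (z o)) -h opprB addrCA addrC.
Qed.

Theorem framework_rigid : exists S b,
  S^T = - S /\ forall i, (i < 96)%N -> motion S b i.
Proof.
have [S [b [hS hb]]] := simplex_motion.
by exists S, b; split=> //; apply: attachable_motion attachments_ok hb.
Qed.

End Framework.
End Evaluation.

(** * Smooth paths in G_4 *)

Section Curves.
Variable R : realType.

(* An algebra of functions closed under differentiation. *)
Inductive elementary : (R -> R) -> Prop :=
  | el_cst c : elementary (fun=> c)
  | el_sin c : elementary (fun t => sin (c * t))
  | el_cos c : elementary (fun t => cos (c * t))
  | el_exp c : elementary (fun t => expR (c * t))
  | el_add f g : elementary f -> elementary g -> elementary (fun t => f t + g t)
  | el_mul f g : elementary f -> elementary g -> elementary (fun t => f t * g t).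

Lemma elementary_derive f : elementary f ->
  exists2 f', elementary f' & forall x, is_derive x (1 : R) f (f' x).
Proof.
elim=> {f} [c|c|c|c|f g _ [f' ef hf] _ [g' eg hg]|f g Ef [f' ef hf] Eg [g' eg hg]].
- by exists (fun=> 0) => [|x]; [exact: el_cst | exact: is_derive_cst].
- exists (fun t => c * cos (c * t)) => [|x]; first exact: el_mul (el_cst _) (el_cos _).
  by apply: is_derive_eq; rewrite /GRing.scale /=; ring.
- exists (fun t => - c * sin (c * t)) => [|x]; first exact: el_mul (el_cst _) (el_sin _).
  by apply: is_derive_eq; rewrite /GRing.scale /=; ring.
- exists (fun t => c * expR (c * t)) => [|x]; first exact: el_mul (el_cst _) (el_exp _).
  by apply: is_derive_eq; rewrite /GRing.scale /=; ring.
- by exists (fun t => f' t + g' t) => [|x]; [exact: el_add | exact: is_deriveD].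
- exists (fun t => f t * g' t + g t * f' t) => [|x].
    by apply: el_add; apply: el_mul.
  exact: is_deriveM.
Qed.

Lemma elementary_smooth e f : elementary f -> smooth_on e f.
Proof.
move=> ef n x _; suff : elementary (derive1n n f).
  by case/elementary_derive => f' _ /(_ x) [].
elim: n => [//|n IH]; rewrite derive1nS; have [f' ef' hf] := elementary_derive IH.
suff -> : derive1 (derive1n n f) = f' by [].
by apply/funext => y; have := hf y; rewrite derive1E => hy; rewrite derive_val.
Qed.

Lemma elementary_sum (I : Type) (s : seq I) (f : I -> R -> R) :
  (forall i, elementary (f i)) -> elementary (fun t => \sum_(i <- s) f i t).
Proof.
move=> h; elim: s => [|i s IH].
  by rewrite (_ : (fun _ => _) = fun=> 0); [exact: el_cst | apply/funext => t; rewrite big_nil].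
rewrite (_ : (fun _ => _) = fun t => f i t + \sum_(j <- s) f j t); first exact: el_add.
by apply/funext => t; rewrite big_cons.
Qed.

Definition elementary_mx m n (F : R -> 'M[R]_(m, n)) : Prop :=
  forall a b, elementary (fun t => F t a b).

Lemma elementary_cst_mx m n (A : 'M[R]_(m, n)) : elementary_mx (fun=> A).
Proof. by move=> a b; exact: el_cst. Qed.

Lemma elementary_mulmx m n p (F : R -> 'M[R]_(m, n)) (G : R -> 'M[R]_(n, p)) :
  elementary_mx F -> elementary_mx G -> elementary_mx (fun t => F t *m G t).
Proof.
move=> hF hG a b; rewrite (_ : (fun _ => _) = fun t => \sum_k F t a k * G t k b).
  by apply: elementary_sum => k; apply: el_mul.
by apply/funext => t; rewrite mxE.
Qed.

Lemma elementary_trmx m n (F : R -> 'M[R]_(m, n)) :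
  elementary_mx F -> elementary_mx (fun t => (F t)^T).
Proof.
move=> hF a b; rewrite (_ : (fun _ => _) = fun t => F t b a) //.
by apply/funext => t; rewrite mxE.
Qed.

Lemma elementary_addmx m n (F G : R -> 'M[R]_(m, n)) :
  elementary_mx F -> elementary_mx G -> elementary_mx (fun t => F t + G t).
Proof.
move=> hF hG a b; rewrite (_ : (fun _ => _) = fun t => F t a b + G t a b); first exact: el_add.
by apply/funext => t; rewrite mxE.
Qed.

Lemma elementary_scalemx m n f (A : 'M[R]_(m, n)) :
  elementary f -> elementary_mx (fun t => f t *: A).
Proof.
move=> hf a b; rewrite (_ : (fun _ => _) = fun t => f t * A a b).
  exact: el_mul hf (el_cst _).
by apply/funext => t; rewrite mxE.
Qed.

(** * Entrywise derivatives of matrix-valued paths *)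

Definition is_mderive m n (t : R) (F : R -> 'M[R]_(m, n)) (F' : 'M[R]_(m, n)) : Prop :=
  forall a b, is_derive t (1 : R) (fun s => F s a b) (F' a b).

Lemma is_mderive_cst m n t (A : 'M[R]_(m, n)) : is_mderive t (fun=> A) 0.
Proof. by move=> a b; rewrite mxE; exact: is_derive_cst. Qed.

Lemma is_mderive_mulmx m n p t (F : R -> 'M[R]_(m, n)) (G : R -> 'M[R]_(n, p)) F' G' :
  is_mderive t F F' -> is_mderive t G G' ->
  is_mderive t (fun s => F s *m G s) (F' *m G t + F t *m G').
Proof.
move=> hF hG a b.
have -> : (fun s => (F s *m G s) a b) = \sum_k (fun s => F s a k * G s k b).
  by apply/funext => s; rewrite mxE fct_sumE.
have h k : is_derive t (1 : R) (fun s => F s a k * G s k b) (F' a k * G t k b + F t a k * G' k b).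
  have := is_deriveM (hF a k) (hG k b).
  by rewrite /GRing.scale /= addrC (mulrC (G t k b)).
by rewrite !mxE -big_split /=; exact: is_derive_sum.
Qed.

Lemma is_mderive_trmx m n t (F : R -> 'M[R]_(m, n)) F' :
  is_mderive t F F' -> is_mderive t (fun s => (F s)^T) F'^T.
Proof.
move=> hF a b; rewrite mxE (_ : (fun _ => _) = fun s => F s b a) //.
by apply/funext => s; rewrite mxE.
Qed.

Lemma is_mderive_sub_cst m n t (F : R -> 'M[R]_(m, n)) F' (A : 'M[R]_(m, n)) :
  is_mderive t F F' -> is_mderive t (fun s => F s - A) F'.
Proof.
move=> hF a b; rewrite (_ : (fun _ => _) = (fun s => F s a b) + cst (- A a b)); last first.
  by apply/funext => s; rewrite !mxE.
by rewrite -[F' a b]addr0; apply: is_deriveD.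
Qed.

(** * Curves of isometries of the Minkowski form *)

Local Notation M := (Mmink R).

Lemma Mmink_tr : M^T = M.
Proof. exact: tr_diag_mx. Qed.

Lemma Mmink_sqr : M *m M = 1%:M.
Proof.
apply/matrixP => i j; rewrite mul_diag_mx !mxE.
by case: (i == j) (i == ord0) => [] []; rewrite /= ?mulr1n ?mulr0n; ring.
Qed.

Lemma minkE (x y : 'cV[R]_5) :
  mink x y = - (x 0 0 * y 0 0) + \sum_(k < 4) x (lift 0 k) 0 * y (lift 0 k) 0.
Proof.
rewrite /mink -mulmxA mul_diag_mx mxE big_ord_recl !mxE eqxx; congr (_ + _); first by ring.
by apply: eq_bigr => k _; rewrite !mxE /= mul1r.
Qed.

Lemma minkC (x y : 'cV[R]_5) : mink x y = mink y x.
Proof. by rewrite !minkE mulrC; congr (_ + _); apply: eq_bigr => k _; rewrite mulrC. Qed.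

(** The velocities at the identity that a path in the group realises; elementary entries ensure that
    the path is smooth. *)
Definition G4_curve (A : 'M[R]_5) : Prop := exists g : R -> 'M[R]_5,
  [/\ elementary_mx g, g 0 = 1%:M, is_mderive 0 g A & forall t, @inG4 R (g t)].

Lemma inG4_mul (g h : 'M[R]_5) : inG4 g -> inG4 h -> inG4 (g *m h).
Proof.
move=> [g1 g2] [h1 h2]; split; last by move=> x /h2/g2; rewrite mulmxA.
have -> : (g *m h)^T *m M *m (g *m h) = h^T *m (g^T *m M *m g) *m h.
  by rewrite trmx_mul !mulmxA.
by rewrite g1 h1.
Qed.

Lemma inG4_1 : inG4 (1%:M : 'M[R]_5).
Proof. by split=> [|x]; rewrite ?trmx1 ?mul1mx ?mulmx1. Qed.

Lemma G4_curve0 : G4_curve 0.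
Proof.
exists (fun=> 1%:M); split=> //; [exact: elementary_cst_mx | exact: is_mderive_cst |].
by move=> _; exact: inG4_1.
Qed.

(** At the identity the velocity of a product of curves is the sum of the velocities, so it suffices
    to realise multiples of a basis of so(1,4). *)
Lemma G4_curveD A B : G4_curve A -> G4_curve B -> G4_curve (A + B).
Proof.
move=> [g [eg g0 dg Gg]] [h [eh h0 dh Gh]]; exists (fun t => g t *m h t); split.
- exact: elementary_mulmx.
- by rewrite g0 h0 mulmx1.
- by have := is_mderive_mulmx dg dh; rewrite g0 h0 mulmx1 mul1mx.
- by move=> t; exact: inG4_mul.
Qed.

Lemma mink_preserved (g : 'M[R]_5) x y : g^T *m M *m g = M -> mink (g *m x) (g *m y) = mink x y.
Proof. by move=> h; rewrite /mink trmx_mul -{2}h !mulmxA. Qed.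

Section OneParameter.
Variables (E : 'M[R]_5) (eps : R).
Hypotheses (ME : E^T *m M = - (M *m E)) (E3 : E *m E *m E = eps *: E).

(** As [E^3 = eps E], the exponential series of a multiple of [E] collapses to this form, as in
    Rodrigues' formula. *)
Definition oneparam (s k : R) : 'M[R]_5 := 1%:M + s *: E + k *: (E *m E).

(** The adjoint for [M] is [oneparam (- s) k], and its product with [oneparam s k] is the identity
    plus [2 k - s^2 + eps k^2] times [E^2]. *)
Lemma oneparam_isometry (s k : R) : 2 * k - s ^+ 2 + eps * k ^+ 2 = 0 ->
  (oneparam s k)^T *m M *m oneparam s k = M.
Proof.
move=> h; have ME2 : (E *m E)^T *m M = M *m (E *m E).
  by rewrite trmx_mul -mulmxA ME mulmxN [E^T *m (_ *m E)]mulmxA ME mulNmx opprK mulmxA.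
have -> : (oneparam s k)^T *m M = M *m oneparam (- s) k.
  rewrite /oneparam !linearD !linearZ /= trmx1 !mulmxDl mul1mx -!scalemxAl ME ME2.
  by rewrite mulmx1 scaleNr scalerN.
rewrite -mulmxA -[RHS]mulmx1; congr (_ *m _); rewrite /oneparam.
have E4 : E *m E *m (E *m E) = eps *: (E *m E) by rewrite mulmxA E3 -scalemxAl.
have E3' : E *m (E *m E) = eps *: E by rewrite mulmxA.
rewrite !mulmxDl !mulmxDr !mul1mx !mulmx1 -!scalemxAl -!scalemxAr E4 E3 E3'.
move: (E *m E) => F; apply/matrixP => a b; rewrite !mxE.
by rewrite -[RHS]addr0 -(mul0r (F a b)) -h; ring.
Qed.

Lemma oneparam_curve c (s k : R -> R) : elementary s -> elementary k ->
  is_derive 0 (1 : R) s c -> is_derive 0 (1 : R) k 0 -> s 0 = 0 -> k 0 = 0 ->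
  (forall t, 2 * k t - s t ^+ 2 + eps * k t ^+ 2 = 0) ->
  (forall t x, inH4 x -> 0 < (oneparam (s t) (k t) *m x) 0 0) ->
  G4_curve (c *: E).
Proof.
move=> es ek ds dk s0 k0 hsk hpos; exists (fun t => oneparam (s t) (k t)); split.
- do 2![apply: elementary_addmx; last exact: elementary_scalemx].
  exact: elementary_cst_mx.
- by rewrite s0 k0 /oneparam !scale0r !addr0.
- move=> a b.
  have -> : (fun t => oneparam (s t) (k t) a b) =
      (fun t => (1%:M : 'M[R]_5) a b + s t * E a b + k t * (E *m E) a b).
    by apply/funext => t; rewrite /oneparam !mxE.
  by apply: is_derive_eq; rewrite [RHS]mxE /GRing.scale /=; ring.
- move=> t; have h := oneparam_isometry (hsk t); split=> // x hx.
  by split; [rewrite mink_preserved //; case: hx | exact: hpos].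
Qed.

End OneParameter.

(** The square of the time coordinate exceeds the sum of the other squares by 1. The bound keeps
    boosts on the upper sheet. *)
Lemma inH4_lt x k : inH4 x -> `|x (lift 0 k) 0| < x 0 0 :> R.
Proof.
case=> hx x0; rewrite -ltr_sqr ?nnegrE ?normr_ge0 ?ltW // real_normK ?num_real //.
move: hx; rewrite minkE (bigD1 k) //=.
have : 0 <= \sum_(i < 4 | i != k) x (lift 0 i) 0 * x (lift 0 i) 0.
  by apply: sumr_ge0 => i _; rewrite -expr2 sqr_ge0.
by move: (\sum_(i < 4 | i != k) _) => S hS; rewrite !expr2 => h; lra.
Qed.

(** [M] times a skew matrix: these span so(1,4), with boosts when exactly one index is 0 and
    rotations when both are positive and distinct. *)
Definition so_gen (i j : 'I_5) : 'M[R]_5 := M *m (delta_mx i j - delta_mx j i).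

Definition axis_sign (i : 'I_5) : R := if i == 0 then -1 else 1.

Lemma Mmink_delta (i j : 'I_5) : M *m delta_mx i j = axis_sign i *: delta_mx i j.
Proof.
apply/matrixP => a b; rewrite mul_diag_mx /axis_sign !mxE.
by have [->|_] := eqVneq a i; rewrite //= !mulr0.
Qed.

Lemma so_genE i j : so_gen i j = axis_sign i *: delta_mx i j - axis_sign j *: delta_mx j i.
Proof. by rewrite /so_gen mulmxBr !Mmink_delta. Qed.

Lemma so_genN i j : so_gen j i = - so_gen i j.
Proof. by rewrite /so_gen -mulmxN opprB. Qed.

Lemma so_gen_skew i j : (so_gen i j)^T *m M = - (M *m so_gen i j).
Proof.
rewrite /so_gen trmx_mul Mmink_tr -mulmxA Mmink_sqr mulmx1 mulmxA Mmink_sqr mul1mx.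
by rewrite linearB /= !trmx_delta opprB.
Qed.

Lemma so_gen_sqr i j : i != j ->
  so_gen i j *m so_gen i j = - (axis_sign i * axis_sign j) *: (delta_mx i i + delta_mx j j).
Proof.
move=> ij; rewrite so_genE mulmxBl !mulmxBr -!scalemxAl -!scalemxAr !mul_delta_mx_cond.
rewrite !eqxx eq_sym (negPf ij) !mulr0n !mulr1n !scaler0 sub0r subr0 !scalerA.
by rewrite scaleNr scalerDr (mulrC (axis_sign j)) opprD.
Qed.

Lemma so_gen_cube i j : i != j ->
  so_gen i j *m so_gen i j *m so_gen i j = - (axis_sign i * axis_sign j) *: so_gen i j.
Proof.
move=> ij; rewrite so_gen_sqr // -scalemxAl; congr (_ *: _).
rewrite so_genE mulmxDl !mulmxBr -!scalemxAr !mul_delta_mx_cond.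
by rewrite !eqxx [j == i]eq_sym !(negPf ij) !mulr0n !mulr1n !scaler0 subr0 add0r.
Qed.

Lemma delta_mulmx0 (i j : 'I_5) (x : 'cV[R]_5) :
  (delta_mx i j *m x) 0 0 = (i == 0)%:R * x j 0.
Proof.
rewrite mxE (bigD1 j) //= big1 ?addr0 => [|k kj]; rewrite mxE.
  by rewrite eqxx andbT eq_sym.
by rewrite (negPf kj) andbF mul0r.
Qed.

Lemma oneparam_mulmx0 (i j : 'I_5) (s k : R) (x : 'cV[R]_5) : i != j ->
  (oneparam (so_gen i j) s k *m x) 0 0 =
  x 0 0 + s * (axis_sign i * ((i == 0)%:R * x j 0) - axis_sign j * ((j == 0)%:R * x i 0))
  - k * (axis_sign i * axis_sign j) * ((i == 0)%:R * x i 0 + (j == 0)%:R * x j 0).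
Proof.
move=> ij.
have D (A B : 'M[R]_5) : ((A + B) *m x) 0 0 = (A *m x) 0 0 + (B *m x) 0 0.
  by rewrite mulmxDl mxE.
have N (A : 'M[R]_5) : (- A *m x) 0 0 = - (A *m x) 0 0 by rewrite mulNmx mxE.
have Z c (A : 'M[R]_5) : ((c *: A) *m x) 0 0 = c * (A *m x) 0 0 by rewrite -scalemxAl mxE.
by rewrite /oneparam so_gen_sqr // so_genE !(D, N, Z) mul1mx !delta_mulmx0; ring.
Qed.

Lemma boost_curve c (j : 'I_4) : G4_curve (c *: so_gen 0 (lift 0 j)).
Proof.
have ne : (0 : 'I_5) != lift 0 j by [].
have cube := so_gen_cube ne; have sqr := so_gen_sqr ne.
rewrite /axis_sign /= mulN1r opprK in cube sqr.
(* Here [s] is the hyperbolic sine of [c t] and [k] its hyperbolic cosine minus 1. *)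
apply: (oneparam_curve (so_gen_skew _ _) cube
  (s := fun t => 2^-1 * expR (c * t) + - 2^-1 * expR (- c * t))
  (k := fun t => 2^-1 * expR (c * t) + 2^-1 * expR (- c * t) + - 1)).
- by apply: el_add; apply: el_mul; [exact: el_cst | exact: el_exp | exact: el_cst | exact: el_exp].
- apply: el_add; [apply: el_add | exact: el_cst];
  by apply: el_mul; [exact: el_cst | exact: el_exp].
- by apply: is_derive_eq; rewrite /GRing.scale /= !mulr0 expR0; field.
- by apply: is_derive_eq; rewrite /GRing.scale /= !mulr0 expR0; field.
- by rewrite !mulr0 expR0; ring.
- by rewrite !mulr0 expR0; field.
- move=> t; rewrite mulNr expRN; have := expR_gt0 (c * t); move: (expR _) => e e0.
  by field; rewrite lt0r_neq0.
(* The new time coordinate is half the sum of the two quantities in [p1] and [p2]. *)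
move=> t x /(inH4_lt j) /ltr_normlP[h1 h2].
have p1 : 0 < expR (c * t) * (x 0 0 - x (lift 0 j) 0).
  by rewrite mulr_gt0 ?expR_gt0 //; lra.
have p2 : 0 < expR (- c * t) * (x 0 0 + x (lift 0 j) 0).
  by rewrite mulr_gt0 ?expR_gt0 //; lra.
by rewrite oneparam_mulmx0 // /axis_sign /=; lra.
Qed.

Lemma rotation_curve c (i j : 'I_4) : i != j -> G4_curve (c *: so_gen (lift 0 i) (lift 0 j)).
Proof.
move=> ij; have ne : lift 0 i != lift 0 j :> 'I_5 by rewrite (inj_eq lift_inj).
have cube := so_gen_cube ne; rewrite /axis_sign /= mulr1 in cube.
apply: (oneparam_curve (so_gen_skew _ _) cube
  (s := fun t => sin (c * t)) (k := fun t => 1 + -1 * cos (c * t))).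
- exact: el_sin.
- by apply: el_add; [exact: el_cst | apply: el_mul; [exact: el_cst | exact: el_cos]].
- by apply: is_derive_eq; rewrite /GRing.scale /= !mulr0 cos0; ring.
- by apply: is_derive_eq; rewrite /GRing.scale /= !mulr0 sin0; ring.
- by rewrite mulr0 sin0.
- by rewrite mulr0 cos0; ring.
- by move=> t; have := cos2Dsin2 (c * t) => h; lra.
by move=> t x [_ hx]; rewrite oneparam_mulmx0 // /axis_sign /= !(mul0r, mulr0, subr0, addr0).
Qed.

Lemma so_gen_curve c i j : G4_curve (c *: so_gen i j).
Proof.
have [<-|ij] := eqVneq i j.
  by rewrite /so_gen subrr mulmx0 scaler0; exact: G4_curve0.
case: (unliftP 0 i) (unliftP 0 j) ij => [i' ->|->] [j' ->|->] ij.
- by apply: rotation_curve; rewrite (inj_eq lift_inj) in ij.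
- by rewrite so_genN scalerN -scaleNr; exact: boost_curve.
- exact: boost_curve.
- by rewrite eqxx in ij.
Qed.

Lemma so_curve (A : 'M[R]_5) : A^T *m M = - (M *m A) -> G4_curve A.
Proof.
move=> hA; have skew i j : (M *m A) i j = - (M *m A) j i.
  have : (M *m A)^T = - (M *m A) by rewrite trmx_mul Mmink_tr.
  by move=> /(congr1 (fun X : 'M[R]_5 => X j i)); rewrite !mxE.
(* The skew matrix [M A] is expanded in elementary matrices; each coordinate plane occurs for both
   orders of its indices, whence the factor 1/2. *)
have -> : A = \sum_i \sum_j ((M *m A) i j / 2) *: so_gen i j.
  rewrite -[LHS]mul1mx -Mmink_sqr -mulmxA.
  under [RHS]eq_bigr => i _ do under eq_bigr => j _ do rewrite scalemxAr.
  under [RHS]eq_bigr => i _ do rewrite -mulmx_sumr.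
  rewrite -mulmx_sumr; congr (_ *m _); apply/esym.
  transitivity (\sum_i \sum_j (M *m A) i j *: delta_mx i j); last by rewrite -matrix_sum_delta.
  rewrite [RHS](_ : _ = \sum_i \sum_j (M *m A) i j / 2 *: delta_mx i j
      + \sum_i \sum_j (M *m A) i j / 2 *: delta_mx i j); last first.
    rewrite -big_split; apply: eq_bigr => i _; rewrite -big_split; apply: eq_bigr => j _.
    by rewrite /= -scalerDl -splitr.
  rewrite [X in _ = _ + X]exchange_big -big_split; apply: eq_bigr => i _; rewrite /= -big_split.
  by apply: eq_bigr => j _; rewrite /= scalerBr [in RHS](skew j) mulNr scaleNr.
elim/big_ind: _ => [||i _]; [exact: G4_curve0 | exact: G4_curveD |].
elim/big_ind: _ => [||j _]; [exact: G4_curve0 | exact: G4_curveD | exact: so_gen_curve].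
Qed.

(** Being polynomial in [g], this form of the inverse can be differentiated by the product rule. *)
Lemma G4_invmx (g : 'M[R]_5) : inG4 g -> invmx g = M *m g^T *m M.
Proof.
case=> h _; have hl : M *m g^T *m M *m g = 1%:M by rewrite -!mulmxA (mulmxA g^T) h Mmink_sqr.
have ug : g \in unitmx by have [] := mulmx1_unit hl.
by rewrite -[LHS]mul1mx -hl mulmxK.
Qed.

(** A curve in the group with velocity [A] at the identity conjugates [rho j] along a path whose
    velocity is the commutator. *)
Lemma conjugation_inf_conjugation (rho v : Vpt R) (A : 'M[R]_5) :
  A^T *m M = - (M *m A) -> (forall j, v j = A *m rho j - rho j *m A) -> inf_conjugation rho v.
Proof.
move=> hA hv; have [g [eg g0 dg Gg]] := so_curve hA.
pose p t : Vpt R := fun j => g t *m rho j *m (M *m (g t)^T *m M).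
have ep j : elementary_mx (fun t => p t j).
  apply: elementary_mulmx; first by apply: elementary_mulmx eg (elementary_cst_mx _).
  apply: elementary_mulmx (elementary_cst_mx _).
  by apply: elementary_mulmx (elementary_cst_mx _) _; exact: elementary_trmx.
exists 1, p; split=> //.
- by move=> j a b; exact: elementary_smooth (ep j a b).
- by apply/funext => j; rewrite /p g0 trmx1 mulmx1 mul1mx Mmink_sqr mulmx1.
- move=> j a b; rewrite derive1E.
  have d := is_mderive_mulmx (is_mderive_mulmx dg (is_mderive_cst 0 (rho j)))
    (is_mderive_mulmx (is_mderive_mulmx (is_mderive_cst 0 M) (is_mderive_trmx dg)) (is_mderive_cst 0 M)).
  have := d a b; rewrite /p => db; rewrite derive_val hv.
  rewrite g0 trmx1 !(mulmx0, mul0mx, addr0, add0r, mulmx1, mul1mx) Mmink_sqr mulmx1.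
  by rewrite -(mulmxA M) hA mulmxN mulmxA Mmink_sqr mul1mx mulmxN.
- by move=> t _; exists (g t); split=> //; apply/funext => j; rewrite G4_invmx.
Qed.

End Curves.

(** * The linearised relations *)

Section Linearisation.
Variable R : realType.
Local Notation M := (Mmink R).
Implicit Types (x y n : 'cV[R]_5) (v : 'M[R]_5).

Lemma mink_mx x y : x^T *m M *m y = (mink x y)%:M.
Proof. by rewrite /mink [LHS]mx11_scalar. Qed.

(** Covers the zero vector that [nrm] returns as default. *)
Lemma reflection0 : reflection (0 : 'cV[R]_5) = 1%:M.
Proof. by rewrite /reflection mul0mx scaler0 subr0. Qed.

Lemma reflection_mul n x : reflection n *m x = x - (2 / mink n n * mink n x) *: n.
Proof.
rewrite /reflection mulmxBl mul1mx -scalemxAl -!mulmxA (mulmxA n^T) mink_mx.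
by rewrite mul_mx_scalar scalerA.
Qed.

Lemma reflection_self n : mink n n != 0 -> reflection n *m n = - n.
Proof.
move=> h; rewrite reflection_mul -mulrA mulVf // mulr1.
by rewrite scalerDl scale1r opprD addrA subrr sub0r.
Qed.

Lemma reflection_orth n x : mink n x = 0 -> reflection n *m x = x.
Proof. by move=> h; rewrite reflection_mul h mulr0 scale0r subr0. Qed.

Lemma reflection_tr n : (reflection n)^T *m M = M *m reflection n.
Proof.
rewrite /reflection linearB linearZ /= trmx1 mulmxBl mulmxBr mul1mx mulmx1 -scalemxAl -scalemxAr.
by rewrite !trmx_mul trmxK Mmink_tr !mulmxA.
Qed.

Lemma reflection_row n x : x^T *m M *m reflection n = (reflection n *m x)^T *m M.
Proof. by rewrite trmx_mul -!mulmxA reflection_tr. Qed.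

Lemma reflection_sqr n : mink n n != 0 -> reflection n *m reflection n = 1%:M.
Proof.
move=> h; rewrite {2}/reflection mulmxBr mulmx1 -scalemxAr (mulmxA _ n) reflection_self //.
by rewrite /reflection mulNmx scalerN opprK subrK.
Qed.

(* The velocity of a moving reflection is determined by the velocity [- v n / 2] of its normal. *)
Lemma reflection_velocity n v : mink n n != 0 ->
  v^T *m M *m reflection n + (reflection n)^T *m M *m v = 0 ->
  v *m reflection n + reflection n *m v = 0 ->
  let w := - 2^-1 *: (v *m n) in
  [/\ mink w n = 0, v^T *m M = M *m v &
      v = - (2 / mink n n) *: (w *m (n^T *m M) + n *m (w^T *m M))].
Proof.
move=> N0 hO hR w; set N := mink n n in N0 *; set rho := reflection n.
(* By [hR], [v] anticommutes with the reflection; in [hO] this makes [v] self-adjoint for the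
   form. *)
have vsym : v^T *m M = M *m v.
  have h : v^T *m M *m rho = M *m v *m rho.
    apply/eqP; rewrite -subr_eq0 -[M *m v *m rho]mulmxA -mulmxN.
    have -> : - (v *m rho) = rho *m v by apply/eqP; rewrite eq_sym -addr_eq0 addrC hR.
    by rewrite mulmxA -reflection_tr hO.
  by rewrite -[LHS]mulmx1 -[RHS]mulmx1 -(reflection_sqr N0) !mulmxA h.
have hB : n^T *m M *m v = (v *m n)^T *m M by rewrite trmx_mul -!mulmxA vsym.
(* With [B = n n^T M] and the reflection [1 - (2 / N) B], [hR] reads [2 v = (2 / N) (v B + B v)]. *)
have vN : N *: v = v *m n *m (n^T *m M) + n *m ((v *m n)^T *m M).
  have -> : v *m n *m (n^T *m M) + n *m ((v *m n)^T *m M) =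
      v *m (n *m (n^T *m M)) + n *m (n^T *m M) *m v.
    by rewrite -hB !mulmxA.
  move: hR; rewrite /rho /reflection -/N; move: (n *m (n^T *m M)) => B.
  rewrite mulmxBr mulmxBl mulmx1 mul1mx -scalemxAr -scalemxAl => h.
  have : v + v = (2 / N) *: (v *m B + B *m v).
    by apply/eqP; rewrite -subr_eq0 scalerDr opprD addrACA h.
  move=> /(congr1 (fun X => (N / 2) *: X)); rewrite scalerA.
  have -> : N / 2 * (2 / N) = 1 by field.
  by rewrite scale1r scalerDr -scalerDl -splitr.
have wE : v *m n = - 2 *: w by rewrite /w scalerA mulrNN mulfV ?scale1r // pnatr_eq0.
(* Applied to [n], the formula [vN] leaves a multiple of [n] by [mink (v n) n], which must
   vanish. *)
have w0 : mink w n = 0.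
  have : N *: (v *m n) = N *: (v *m n) + mink (v *m n) n *: n.
    by rewrite [LHS]scalemxAl [in LHS]vN mulmxDl -!mulmxA !(mulmxA _^T) !mink_mx
               !mul_mx_scalar -scalemxAr.
  move=> /eqP; rewrite addrC -subr_eq subrr eq_sym scaler_eq0 => /orP[/eqP|/eqP n0].
    by move=> h; rewrite /mink /w linearZ /= -!scalemxAl mxE [X in _ * X]h mulr0.
  by move: N0; rewrite /N n0 /mink mulmx0 mxE eqxx.
move: w wE w0 => w wE w0; split=> //; apply: (scalerI N0); rewrite vN wE.
have -> : (- 2 *: w)^T = - 2 *: w^T by rewrite linearZ.
rewrite -!scalemxAl -scalemxAr -scalerDr scalerA.
by congr (_ *: _); field.
Qed.

(* The commutation relation, applied to [ni] on the left and [nj] on the right. *)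
Lemma commutation_velocity ni nj vi vj :
  mink ni ni != 0 -> mink nj nj != 0 -> mink ni nj = 0 ->
  vi^T *m M = M *m vi ->
  let ri := reflection ni in let rj := reflection nj in
  vi *m rj *m ri *m rj + ri *m vj *m ri *m rj + ri *m rj *m vi *m rj + ri *m rj *m ri *m vj = 0 ->
  mink (vi *m ni) nj + mink ni (vj *m nj) = 0.
Proof.
move=> Ni Nj hij symi ri rj h.
have hji : mink nj ni = 0 by rewrite minkC.
have rii : ri *m ni = - ni by exact: reflection_self.
have rjj : rj *m nj = - nj by exact: reflection_self.
have rij : ri *m nj = nj by exact: reflection_orth.
have rji : rj *m ni = ni by exact: reflection_orth.
have lri : ni^T *m M *m ri = - (ni^T *m M) by rewrite reflection_row rii linearN mulNmx.
have lrj : ni^T *m M *m rj = ni^T *m M by rewrite reflection_row rji.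
have lv : ni^T *m M *m vi = (vi *m ni)^T *m M by rewrite trmx_mul -!mulmxA symi.
clearbody ri rj.
(* Both normals are eigenvectors of both reflections, so every reflection turns into a sign, and
   each of the two products of the conclusion comes out twice. *)
have := congr1 (fun X => ni^T *m M *m (X *m nj)) h; rewrite /= mul0mx mulmx0.
have t1 : vi *m rj *m ri *m rj *m nj = vi *m nj.
  by rewrite -!mulmxA rjj !mulmxN rij rjj mulmxN opprK.
have t2 : ri *m vj *m ri *m rj *m nj = - (ri *m (vj *m nj)).
  by rewrite -!mulmxA rjj !mulmxN rij.
have t3 : ri *m rj *m vi *m rj *m nj = - (ri *m (rj *m (vi *m nj))).
  by rewrite -!mulmxA rjj !mulmxN.
rewrite !mulmxDl t1 t2 t3 -!mulmxA !mulmxDr !mulmxN.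
have L x : ni^T *m (M *m (ri *m x)) = - (ni^T *m (M *m x)).
  by rewrite !mulmxA lri mulNmx -mulmxA.
have L' x : ni^T *m (M *m (rj *m x)) = ni^T *m (M *m x).
  by rewrite !mulmxA lrj.
have L'' x : ni^T *m (M *m (vi *m x)) = (vi *m ni)^T *m (M *m x).
  by rewrite !mulmxA lv.
rewrite !(L, L', L'') !opprK !(mulmxA _^T) !mink_mx => /(congr1 (fun X : 'M[R]_1 => X 0 0)).
by rewrite !mxE eqxx !mulr1n; lra.
Qed.

Lemma derive1_is_derive (f : R -> R) (t : R) l :
  derivable f t 1 -> derive1 f t = l -> is_derive t (1 : R) f l.
Proof. by move=> df <-; split=> //; rewrite derive1E. Qed.

Lemma is_mderive_unique m k t (F : R -> 'M[R]_(m, k)) F' :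
  is_mderive t F F' -> (forall a b, derive1 (fun s => F s a b) t = 0) -> F' = 0.
Proof.
by move=> dF F0; apply/matrixP => a b; have d := dF a b; rewrite mxE -(F0 a b) derive1E derive_val.
Qed.

Section Deformation.
Variables (rho v : Vpt R).
Hypothesis def_v : inf_deformation rho v.

Lemma deformation_equations :
  [/\ forall j, (v j)^T *m M *m rho j + (rho j)^T *m M *m v j = 0,
      forall j, v j *m rho j + rho j *m v j = 0 &
      forall i j, walls_meet R i j ->
        v i *m rho j *m rho i *m rho j + rho i *m v j *m rho i *m rho j
        + rho i *m rho j *m v i *m rho j + rho i *m rho j *m rho i *m v j = 0].
Proof.
have [e [p [e0 sp p0 tp [hO hR hC]]]] := def_v.
have d j : is_mderive 0 (fun t => p t j) (v j).
  move=> a b; apply: derive1_is_derive; last exact: tp.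
  (* Order 0 of smoothness gives derivability at 0, without which [derive1] says nothing. *)
  by apply: (sp j a b 0%N); rewrite oppr_lt0 e0.
have ej j : p 0 j = rho j by rewrite p0.
split=> [j|j|i j /hC ij].
- have h := is_mderive_mulmx (is_mderive_mulmx (is_mderive_trmx (d j)) (is_mderive_cst 0 M)) (d j).
  have := is_mderive_unique (is_mderive_sub_cst M h) (hO j).
  by rewrite mulmx0 addr0 ej.
- have := is_mderive_unique (is_mderive_sub_cst 1%:M (is_mderive_mulmx (d j) (d j))) (hR j).
  by rewrite ej.
- have h := is_mderive_mulmx (is_mderive_mulmx (is_mderive_mulmx (d i) (d j)) (d i)) (d j).
  have := is_mderive_unique (is_mderive_sub_cst 1%:M h) ij.
  by rewrite !ej !mulmxDl.
Qed.

End Deformation.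
End Linearisation.

(** * The walls of the 120-cell *)

Definition word_perm (l : word) : {perm 'I_4} :=
  (tperm (inord l.1.1) (inord l.1.2) * tperm (inord l.2.1) (inord l.2.2))%g.

Lemma tperm_swap a b (k : 'I_4) : (a < 4)%N -> (b < 4)%N ->
  tperm (inord a) (inord b) k = swap a b k :> nat.
Proof.
move=> ha hb; rewrite /swap; case: tpermP => [->|->|/eqP h1 /eqP h2]; rewrite ?inordK ?eqxx //.
  by case: eqP.
by rewrite -!val_eqE /= !inordK // in h1 h2; rewrite (negPf h1) (negPf h2).
Qed.

Lemma words_proper l : l \in words ->
  [&& l.1.1 < 4, l.1.2 < 4, l.2.1 < 4, l.2.2 < 4, l.1.1 != l.1.2 & l.2.1 != l.2.2]%N.
Proof. by move: l; apply/allP. Qed.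

Lemma word_permE l (k : 'I_4) : l \in words -> word_perm l k = word_fun l k :> nat.
Proof.
by move=> /words_proper/and5P[h1 h2 h3 h4 _]; rewrite permM !tperm_swap.
Qed.

Lemma word_perm_even l : l \in words -> ~~ odd_perm (word_perm l).
Proof.
move=> /words_proper/and5P[h1 h2 h3 h4 /andP[h5 h6]].
by rewrite odd_permM !odd_tperm -!val_eqE /= !inordK // h5 h6.
Qed.

(** The two remaining letters are fixed or exchanged, and the exchange is odd. *)
Lemma even_perm_fix2 (p : {perm 'I_4}) : ~~ odd_perm p ->
  p (inord 0) = inord 0 -> p (inord 1) = inord 1 -> p = 1%g.
Proof.
move=> ev p0 p1.
have dom (k : 'I_4) : k \in [:: inord 0; inord 1; inord 2; inord 3].
  by rewrite -[k]inord_val; case: k => [[|[|[|[|]]]]] //= _; rewrite !inE eqxx ?orbT.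
have ne a b : (a < 4)%N -> (b < 4)%N -> a != b -> inord a != inord b :> 'I_4.
  by move=> ha hb; rewrite -val_eqE /= !inordK.
have inj a b : (a < 4)%N -> (b < 4)%N -> a != b -> p (inord a) != p (inord b).
  by move=> ha hb ab; rewrite (inj_eq perm_inj); exact: ne.
have := dom (p (inord 2)); have := dom (p (inord 3)).
have := inj 2 0 isT isT isT; have := inj 2 1 isT isT isT.
have := inj 3 0 isT isT isT; have := inj 3 1 isT isT isT; have := inj 2 3 isT isT isT.
rewrite p0 p1 !inE => h23 /negPf-> /negPf-> /negPf-> /negPf-> /=.
case/orP => /eqP p3 /orP[] /eqP p2; move: h23; rewrite p2 p3 ?eqxx // => _; last first.
  apply/permP => k; rewrite perm1.
  by have := dom k; rewrite !inE => /or4P[] /eqP ->.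
have pE : p = tperm (inord 2) (inord 3).
  apply/permP => k; have := dom k; rewrite !inE => /or4P[] /eqP ->;
  by rewrite ?tpermL ?tpermR ?p0 ?p1 // tpermD // ne.
by move: ev; rewrite pE odd_tperm ne.
Qed.

(** Two images determine an even permutation, and a finite search finds every pair of distinct
    images among the words. *)
Lemma even_perm_word (p : {perm 'I_4}) : ~~ odd_perm p -> exists2 l, l \in words & p = word_perm l.
Proof.
move=> ev; have : p (inord 0) != p (inord 1).
  by rewrite (inj_eq perm_inj) -val_eqE /= !inordK.
have search : all (fun a => all (fun b => (a == b) ||
    has (fun l => (word_fun l 0 == a) && (word_fun l 1 == b)) words) (iota 0 4)) (iota 0 4) by [].
have lt4 (k : 'I_4) : nat_of_ord k \in iota 0 4 by rewrite mem_iota /= ltn_ord.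
have := allP (allP search _ (lt4 (p (inord 0)))) _ (lt4 (p (inord 1))).
rewrite -val_eqE => /orP[-> //|/hasP[l hl /andP[/eqP l0 /eqP l1]]] _; exists l => //.
have e0 : word_perm l (inord 0) = p (inord 0) by apply: ord_inj; rewrite word_permE // inordK.
have e1 : word_perm l (inord 1) = p (inord 1) by apply: ord_inj; rewrite word_permE // inordK.
apply/eqP; rewrite eq_mulgV1; apply/eqP/even_perm_fix2.
- by rewrite odd_permM odd_permV (negPf ev) (negPf (word_perm_even hl)).
- by rewrite permM -e0 permK.
- by rewrite permM -e1 permK.
Qed.

Lemma sign_in_signs (e : bool * bool * bool) : e \in signs.
Proof. by case: e => [[[] []] []]. Qed.

Lemma lab_in_labels i : lab i \in labels.
Proof.
rewrite /lab; have [h|h] := ltnP i (size labels); first exact: mem_nth.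
by rewrite nth_default.
Qed.

Lemma label_word x : x \in labels -> x.1 \in words.
Proof. by case/allpairsP => -[l e] [/= hl _ ->]. Qed.

Definition wall_params : seq ((bool * bool * bool) * {perm 'I_4}) :=
  enum [pred x : (bool * bool * bool) * {perm 'I_4} | ~~ odd_perm x.2].

Definition label_param (x : label) := (x.2, word_perm x.1).

Lemma wall_params_label y : y \in wall_params -> exists2 i, (i < 96)%N & y = label_param (lab i).
Proof.
rewrite mem_enum => /even_perm_word[l hl yl].
have hx : (l, y.1) \in labels by apply: allpairs_f => //; exact: sign_in_signs.
exists (index (l, y.1) labels); first by have := hx; rewrite -index_mem.
by rewrite /lab nth_index // /label_param /= -yl; case: y {yl hx}.
Qed.

Lemma label_param_wall i : label_param (lab i) \in wall_params.
Proof. by rewrite mem_enum; apply: word_perm_even; apply: label_word; exact: lab_in_labels. Qed.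

Lemma size_wall_params : (size wall_params <= 96)%N.
Proof.
have <- : size [seq label_param (lab i) | i <- iota 0 96] = 96%N by rewrite size_map size_iota.
apply: uniq_leq_size; first exact: enum_uniq.
by move=> y /wall_params_label[i hi ->]; apply/mapP; exists i; rewrite ?mem_iota.
Qed.

(** Translates the explicit numbering of labels into the position in the enumeration behind
    [normals96], whose order stays unknown. *)
Definition wall (i : nat) : 'I_96 := inord (index (label_param (lab i)) wall_params).

Lemma wallE i : wall i = index (label_param (lab i)) wall_params :> nat.
Proof.
rewrite inordK //; apply: leq_trans size_wall_params.
by rewrite index_mem label_param_wall.
Qed.

(* The second alternative never occurs; it costs less to allow it than to count even permutations. *)
Lemma wall_surj (j : 'I_96) :
  (exists2 i, (i < 96)%N & j = wall i) \/ (size wall_params <= j)%N.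
Proof.
have [hj|hj] := ltnP j (size wall_params); [left | by right].
have y0 := label_param (lab 0); have [i hi e] := wall_params_label (mem_nth y0 hj).
exists i => //; apply: ord_inj; rewrite wallE -e index_uniq //; exact: enum_uniq.
Qed.

(** * The normals as real vectors and their Minkowski products *)

Section Walls.
Variable R : realType.
Local Notation tau := (tau R).
Local Notation s := (Num.sqrt (2 * tau)).
Local Notation W i := (zv_eval R (vtx i)).

Definition normal (w : 'rV[R]_4) : 'cV[R]_5 := vec5 s (fun k => w 0 k).

Lemma s_sqr : s * s = 2 * tau.
Proof. by have /andP[h _] := tau_bounds R; rewrite -expr2 sqr_sqrtr //; lra. Qed.

Lemma s_gt0 : 0 < s.
Proof. by have /andP[h _] := tau_bounds R; rewrite sqrtr_gt0; lra. Qed.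

Lemma normal_0 w : normal w 0 0 = s.
Proof. by rewrite mxE unlift_none. Qed.

Lemma normal_lift w k : normal w (lift 0 k) 0 = w 0 k.
Proof. by rewrite mxE liftK. Qed.

Lemma mink_normalr (x : 'cV[R]_5) w :
  mink x (normal w) = - (s * x 0 0) + dotp (\row_k x (lift 0 k) 0) w.
Proof.
rewrite minkE normal_0 mulrC; congr (_ + _).
by apply: eq_bigr => k _; rewrite normal_lift mxE.
Qed.

Lemma mink_normal w w' : mink (normal w) (normal w') = - (2 * tau) + dotp w w'.
Proof.
rewrite mink_normalr normal_0 s_sqr; congr (_ + dotp _ _).
by apply/rowP => k; rewrite mxE normal_lift.
Qed.

Lemma minkDr (x y z : 'cV[R]_5) : mink x (y + z) = mink x y + mink x z.
Proof. by rewrite /mink mulmxDr mxE. Qed.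

Lemma minkZr c (x y : 'cV[R]_5) : mink x (c *: y) = c * mink x y.
Proof. by rewrite /mink -scalemxAr mxE. Qed.

Lemma minkZl c (x y : 'cV[R]_5) : mink (c *: x) y = c * mink x y.
Proof. by rewrite minkC minkZr minkC. Qed.

Lemma zt_sign_eval b x : zt_eval R (zt_sign b x) = sgb R b * zt_eval R x.
Proof. by case: b; rewrite /sgb /= ?zt_evalN ?mul1r ?mulN1r. Qed.

Lemma zt_eval_tau : zt_eval R (0, 1)%ZZ = tau.
Proof. by rewrite /zt_eval /= mul1r add0r. Qed.
Lemma zt_eval1 : zt_eval R (1, 0)%ZZ = 1.
Proof. by rewrite /zt_eval /= mul0r addr0. Qed.
Lemma zt_eval_tauV : zt_eval R (-1, 1)%ZZ = tau^-1.
Proof. by rewrite /zt_eval /= mul1r tau_inv addrC. Qed.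

Lemma wbase_vertex x (k : 'I_4) : x.1 \in words ->
  wbase R x.2 (word_perm x.1 k) = zv_eval R (vertex x) 0 k.
Proof.
move=> hl; rewrite mxE nth_mkseq // -word_permE // /wbase /base_coord.
case: (word_perm x.1 k) => [[|[|[|[|]]]]] //= _;
  by rewrite ?zt_sign_eval ?zt_eval_tau ?zt_eval_tauV ?zt_eval1 ?mulr1 // zt_eval0.
Qed.

Lemma normals96E : normals96 R =
  [seq vec5 s (fun k => wbase R x.1 (x.2 k))
    | x : (bool * bool * bool) * {perm 'I_4} <- wall_params].
Proof. by []. Qed.

Lemma normal_vtx i : normal (W i) = vec5 s (fun k => wbase R (lab i).2 (word_perm (lab i).1 k)).
Proof.
rewrite /normal /vtx.
have -> : nth (vertex label0) vertices i = vertex (lab i).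
  rewrite /vertices /lab; have [h|h] := ltnP i (size labels); first exact: nth_map.
  by rewrite !nth_default ?size_map.
congr vec5; apply/funext => k; rewrite wbase_vertex //.
by apply: label_word; exact: lab_in_labels.
Qed.

Lemma nrm_wall i : nrm R (wall i) = normal (W i).
Proof.
rewrite /nrm wallE normals96E normal_vtx.
rewrite (nth_map (label_param (lab i))) ?index_mem ?label_param_wall //.
by rewrite nth_index // label_param_wall.
Qed.

Lemma nrm_default (j : 'I_96) : (size wall_params <= j)%N -> nrm R j = 0.
Proof. by move=> h; rewrite /nrm normals96E nth_default // size_map. Qed.

Lemma normals_eval m : m \in normalsC R ++ normals96 R ->
  exists2 c, c \in centers ++ vertices & m = normal (zv_eval R c).
Proof.
rewrite !mem_cat -orbA => /or3P[/mapP[[k b] _ ->]|/mapP[e _ ->]|].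
- exists (mkseq (fun i => if i == k then (if b then (2, 0) else (-2, 0))%ZZ else zt0) 4).
    rewrite mem_cat; apply/orP; left.
    by case: k => [[|[|[|[|]]]]] //= _; case: b; vm_compute.
  congr vec5; apply/funext => i; rewrite !mxE nth_mkseq // -val_eqE /=; case: eqP => _.
    by case: b; rewrite /zt_eval /sgb /= mul0r addr0 ?mul1r ?mulN1r.
  by rewrite zt_eval0.
- exists [seq zt_sign (e k) (1, 0)%ZZ | k <- [:: inord 0; inord 1; inord 2; inord 3]].
    rewrite mem_cat; apply/orP; left; rewrite /=.
    by case: (e _) (e _) (e _) (e _) => [] [] [] [].
  congr vec5; apply/funext => i; rewrite !mxE -{1}[i]inord_val.
  by case: i => [[|[|[|[|]]]]] //= _; rewrite zt_sign_eval zt_eval1 mulr1.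
rewrite normals96E => /mapP[y /wall_params_label[i hi ->] ->].
exists (vtx i); last by rewrite normal_vtx.
rewrite mem_cat; apply/orP; right; apply: mem_nth; exact: hi.
Qed.

Lemma dotp_edge i j : edge i j -> dotp (W i) (W j) = 2 * tau.
Proof.
move=> /zt_eq_eval-/(_ R); rewrite zv_eval_dot => ->.
by rewrite /zt_eval /= add0r.
Qed.

Lemma vtx_in i : vtx i \in vertices.
Proof.
rewrite /vtx; have [h|h] := ltnP i (size vertices); first exact: mem_nth.
by rewrite nth_default.
Qed.

Lemma vertices_dot4 : all (fun x => zt_eq (zv_dot x x) (4, 0)%ZZ) vertices.
Proof. by vm_compute. Qed.

Lemma dotp_vtx i : dotp (W i) (W i) = 4.
Proof.
have := allP vertices_dot4 _ (vtx_in i) => /zt_eq_eval-/(_ R); rewrite zv_eval_dot => ->.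
by rewrite /zt_eval /= mul0r addr0.
Qed.

Lemma mink_nrm i : mink (normal (W i)) (normal (W i)) = 4 - 2 * tau.
Proof. by rewrite mink_normal dotp_vtx addrC. Qed.

Lemma mink_nrm_neq0 i : mink (normal (W i)) (normal (W i)) != 0.
Proof. by have /andP[h1 h2] := tau_bounds R; rewrite mink_nrm; apply/lt0r_neq0; lra. Qed.

Lemma dots_bound i c : c \in centers ++ vertices ->
  dotp (W i) (zv_eval R c) <= 2 * tau \/ W i = zv_eval R c.
Proof.
move=> hc; have := allP (allP dots_small _ (vtx_in i)) _ hc.
move=> /orP[/hasP[d hd /zt_eq_eval-/(_ R)]|/zv_eq_eval-/(_ R)]; last by right.
rewrite zv_eval_dot => ->; left; have /andP[h1 h2] := tau_bounds R.
have {hd} : d \in dot_values := hd; rewrite !inE.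
by do ![case/orP]; move=> /eqP ->; rewrite /zt_eval /= ?/Pos.to_nat /=; lra.
Qed.

Lemma edge_walls_meet i j : edge i j -> walls_meet R (wall i) (wall j).
Proof.
move=> hij; have /andP[t1 t2] := tau_bounds R; have dij := dotp_edge hij.
have s0 := s_gt0; have ss := s_sqr; have dC := dotpC (W i) (W j).
split.
  apply/negP => /eqP e; have : normal (W i) = normal (W j) by rewrite -!nrm_wall e.
  move=> /(congr1 (fun n => mink (normal (W i)) n)); rewrite !mink_normal dotp_vtx dij; lra.
(* The common point [y] is the orthogonal projection of the centre [e0] to both walls: each normal
   has product [- s] with [e0] and norm [4 - 2 tau]. *)
pose a := s / (4 - 2 * tau).
have a0 : 0 < a by rewrite divr_gt0 //; lra.
have ha : a * (4 - 2 * tau) = s by rewrite divfK //; apply/lt0r_neq0; lra.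
pose e0 : 'cV[R]_5 := delta_mx 0 0.
pose y : 'cV[R]_5 := e0 + a *: (normal (W i) + normal (W j)).
have y0 : y 0 0 = 1 + 2 * a * s by rewrite !mxE !unlift_none eqxx /=; ring.
pose q := 1 + 2 * a * s; have q0 : 0 < q by rewrite /q; nra.
have my w : mink y (normal w) = - s + a * (- (4 * tau) + dotp (W i) w + dotp (W j) w).
  rewrite mink_normalr y0.
  have -> : \row_k y (lift 0 k) 0 = a *: (W i + W j).
    by apply/rowP => k; rewrite !mxE !liftK /= add0r !mxE.
  by rewrite dotpZl dotpDl mulrDr mulr1 opprD -!addrA; congr (_ + _); rewrite mulrCA ss; ring.
have yi : mink y (normal (W i)) = 0 by rewrite my dotp_vtx -dC dij; lra.
have yj : mink y (normal (W j)) = 0 by rewrite my dotp_vtx dij; lra.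
(* As [y] is orthogonal to both normals, its product with itself is that with [e0]; dividing by [r]
   then puts it on the hyperboloid. *)
have yy : mink y y = - q.
  rewrite {2}/y minkDr minkZr minkDr yi yj addr0 mulr0 addr0 minkE big1 => [|k _].
    by rewrite y0 !mxE !eqxx mulr1 addr0.
  by rewrite [e0 _ _]mxE /= mulr0.
pose r := Num.sqrt q; have r0 : 0 < r by rewrite sqrtr_gt0.
have rr : r * r = q by rewrite -expr2 sqr_sqrtr // ltW.
have rV : r^-1 * r^-1 * q = 1 by rewrite -rr; field; exact: lt0r_neq0.
exists (r^-1 *: y); rewrite !nrm_wall !minkZl yi yj !mulr0; split=> //; split.
  split; first by rewrite minkZl minkZr yy mulrA mulrN rV.
  by rewrite mxE y0 mulr_gt0 ?invr_gt0.
move=> m /normals_eval[c hc ->]; rewrite minkZl pmulr_rle0 ?invr_gt0 // my.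
(* Equality holds for the two walls themselves; for any other normal the sum is at most [4 tau]. *)
suff : dotp (W i) (zv_eval R c) + dotp (W j) (zv_eval R c) <= 4 + 2 * tau by nra.
have [h|h] := dots_bound i hc; last by rewrite -h dotp_vtx -dC dij.
have [h'|h'] := dots_bound j hc; last by rewrite -h' dotp_vtx dij addrC.
lra.
Qed.
End Walls.

(** * From velocities of the normals to an element of so(1,4) *)

Section Assembly.
Variable R : realType.
Local Notation M := (Mmink R).
Local Notation s := (Num.sqrt (2 * tau R)).
Local Notation W i := (zv_eval R (vtx i)).

Definition spatial (x : 'cV[R]_5) : 'rV[R]_4 := \row_k x (lift 0 k) 0.

(* The infinitesimal isometry of H^4 extending the Euclidean motion [x |-> x S + b] of the
   affine hyperplane of height [s] that contains all normals. *)
Definition motion_mx (S : 'M[R]_4) (b : 'rV[R]_4) : 'M[R]_5 :=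
  \matrix_(p, q) match unlift 0 p, unlift 0 q with
    | Some k, Some l => S l k
    | Some k, None | None, Some k => b 0 k / s
    | None, None => 0
    end.

Lemma motion_mx_so S b : S^T = - S -> (motion_mx S b)^T *m M = - (M *m motion_mx S b).
Proof.
move=> hS; have skew k l : S k l = - S l k.
  by have /matrixP/(_ l k) := hS; rewrite !mxE.
apply/matrixP => p q; rewrite mul_mx_diag [RHS]mxE mul_diag_mx !mxE.
case: (unliftP 0 p) (unliftP 0 q) => [k ->|->] [l ->|->] /=;
  rewrite ?eqxx ?liftK ?unlift_none /=; last by ring.
- by rewrite (skew k l); ring.
- by ring.
- by ring.
Qed.

Lemma motion_mx_normal S b w :
  motion_mx S b *m normal w = \col_p (if unlift 0 p is Some k then (w *m S + b) 0 k else dotp b w / s).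
Proof.
have s0 : s != 0 by apply/lt0r_neq0/s_gt0.
apply/colP => p; rewrite !mxE big_ord_recl normal_0 [motion_mx _ _ _ 0]mxE unlift_none.
under eq_bigr => k _ do rewrite normal_lift [motion_mx _ _ _ _]mxE liftK.
case: (unlift 0 p) => [k|].
  rewrite divfK // addrC !mxE; congr (_ + _).
  by apply: eq_bigr => l _; rewrite mulrC.
by rewrite mul0r add0r /dotp mulr_suml; apply: eq_bigr => k _; rewrite mulrAC.
Qed.

Lemma spatial_velocity (x : 'cV[R]_5) w : mink x (normal w) = 0 -> s * x 0 0 = dotp (spatial x) w.
Proof. by rewrite mink_normalr => h; lra. Qed.

(** Orthogonality of [u i] to its normal expresses the time coordinate through the spatial part.
    Once it is eliminated, the condition on an edge says that the bar is preserved by the spatial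
    parts. *)
Lemma velocities_of_motion (u : nat -> 'cV[R]_5) :
  (forall i, mink (u i) (normal (W i)) = 0) ->
  (forall i j, edge i j -> mink (u i) (normal (W j)) + mink (u j) (normal (W i)) = 0) ->
  exists2 A : 'M[R]_5, A^T *m M = - (M *m A) & forall i, (i < 96)%N -> u i = A *m normal (W i).
Proof.
move=> u0 ue; have hu i := spatial_velocity (u0 i).
have pres i j : edge i j -> preserved (fun i => spatial (u i)) i j.
  move=> /ue; rewrite /preserved !mink_normalr -/(spatial _) -/(spatial _) => h.
  by rewrite dotpBl !dotpBr -!hu; lra.
have [S [b [hS hm]]] := framework_rigid pres.
exists (motion_mx S b); first exact: motion_mx_so.
move=> i /hm; rewrite /motion motion_mx_normal => hi.
have s0 : s != 0 by apply/lt0r_neq0/s_gt0.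
apply/colP => p; rewrite [RHS]mxE; case: (unliftP 0 p) => [k ->|->].
  by rewrite -hi mxE.
(* The time coordinate is forced, and the skew part of the motion does not contribute to it. *)
apply: (mulfI s0); rewrite hu hi dotpDl dotp_skew // add0r.
by rewrite mulrCA mulfV ?mulr1.
Qed.

End Assembly.

Theorem theorem4p1 (R : realType) : inf_rigid (@rho0 R).
Proof.
move=> v /deformation_equations[hO hR hC].
pose n i := normal (zv_eval R (vtx i)); pose vi i := v (wall i).
have rhoE i : rho0 R (wall i) = reflection (n i) by rewrite /rho0 nrm_wall.
have hO' i : (vi i)^T *m Mmink R *m reflection (n i) + (reflection (n i))^T *m Mmink R *m vi i = 0.
  by rewrite -rhoE hO.
have hR' i : vi i *m reflection (n i) + reflection (n i) *m vi i = 0 by rewrite -rhoE hR.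
pose u i : 'cV[R]_5 := - 2^-1 *: (vi i *m n i).
have [u0 us uv] : [/\ forall i, mink (u i) (n i) = 0,
    forall i, (vi i)^T *m Mmink R = Mmink R *m vi i &
    forall i, vi i = - (2 / mink (n i) (n i)) *:
      (u i *m ((n i)^T *m Mmink R) + n i *m ((u i)^T *m Mmink R))].
  have vel i : [/\ mink (u i) (n i) = 0, (vi i)^T *m Mmink R = Mmink R *m vi i & vi i = _] :=
    reflection_velocity (mink_nrm_neq0 R i) (hO' i) (hR' i).
  by split=> i; have [] := vel i.
have ue i j : edge i j -> mink (u i) (n j) + mink (u j) (n i) = 0.
  move=> ij; have hij : mink (n i) (n j) = 0 by rewrite mink_normal dotp_edge // addNr.
  have := hC _ _ (edge_walls_meet R ij); rewrite !rhoE => h.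
  have := commutation_velocity (mink_nrm_neq0 R i) (mink_nrm_neq0 R j) hij (us i) h.
  by rewrite /u !minkZl (minkC (n i)) -mulrDr => ->; rewrite mulr0.
have [A hA huA] := velocities_of_motion u0 ue.
apply: (conjugation_inf_conjugation hA) => j; have [[i hi ->]|hj] := wall_surj j.
  (* With [u i = A n] and [A] in so(1,4), [(u i)^T M] is [- n^T M A], which turns the formula [uv]
     into the commutator. *)
  rewrite -/(vi i) uv rhoE huA // /reflection -/(n i); move: (2 / _) => c.
  rewrite trmx_mul -[(n i)^T *m A^T *m _]mulmxA hA mulmxN mulmxBr mulmxBl mulmx1 mul1mx.
  rewrite -scalemxAr -scalemxAl !mulmxN scaleNr -scalerN !mulmxA.
  by apply/matrixP => a b; rewrite !mxE; ring.
(* At a default index the reflection is the identity: [hR] gives [v j + v j = 0], and the commutator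
   is zero as well. *)
have r1 : rho0 R j = 1%:M by rewrite /rho0 nrm_default // reflection0.
have := hR j; rewrite r1 !mulmx1 !mul1mx => h; rewrite subrr.
by apply/matrixP => a b; move/matrixP/(_ a b): h; rewrite !mxE; lra.
Qed.
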